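(* Let $R$ be an associative ring with identity and let $\mathcal{B}$ be a class of right $R$-modules with $\mathcal{I}(R^{\mathrm{op}}) \subseteq \mathcal{B}$ and such that $\mathcal{GF}_{\mathcal{B}}$ is closed under extensions. Then $\mathrm{l.w.Ggl}_{\mathcal{B}}(R)$ is finite if and only if both $\mathrm{fd}(\mathcal{B})$ and $\mathrm{fd}(\mathcal{I}(R))$ are finite.
   Context: $\mathrm{Mod}(R)$ is the category of left $R$-modules; $\mathcal{I}(R)$ and $\mathcal{I}(R^{\mathrm{op}})$ are the classes of injective left and injective right $R$-modules, respectively. For a class $\mathcal{X}$ of modules, $\mathrm{fd}(\mathcal{X}) := \sup\{\mathrm{fd}(X) : X \in \mathcal{X}\}$, where $\mathrm{fd}$ is flat dimension. A left $R$-module $G$ is Gorenstein $\mathcal{B}$-flat if $G \cong \mathrm{Ker}(F^0 \to F^1)$ for some exact complex $\cdots \to F_1 \to F_0 \to F^0 \to F^1 \to \cdots$ of flat left $R$-modules which remains exact after applying $B \otimes_R -$ for every $B \in \mathcal{B}$. The class of all such modules is $\mathcal{GF}_{\mathcal{B}}$. For a left $R$-module $M$, $\mathrm{Gfd}_{\mathcal{B}}(M)$ is the $\mathcal{GF}_{\mathcal{B}}$-resolution dimension of $M$: the least $k \geq 0$ for which there is an exact sequence $0 \to G_k \to \cdots \to G_0 \to M \to 0$ with all $G_i \in \mathcal{GF}_{\mathcal{B}}$ ($\infty$ if no such $k$ exists). Finally $\mathrm{l.w.Ggl}_{\mathcal{B}}(R) := \sup\{\mathrm{Gfd}_{\mathcal{B}}(M)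 : M \in \mathrm{Mod}(R)\}$. *)

(* Defs.v *)
From HB Require Import structures.
From mathcomp Require Import all_boot all_order all_algebra.
From mathcomp Require Import generic_quotient ring_quotient.
From mathcomp Require Import boolp classical_sets constructive_ereal.
From mathcomp Require Import freeg.

Set Implicit Arguments.
Unset Strict Implicit.
Unset Printing Implicit Defensive.

Import Order.TTheory GRing.Theory Num.Theory.
Import Quotient.Exports.

Local Open Scope ring_scope.
Local Open Scope quotient_scope.

Definition id_module (R : pzRingType) (M : lmodType R) : {linear M -> M} :=
  @idfun M.

Section Exactness.

Definition exact_at (A B C : zmodType) (f : A -> B) (g : B -> C) : Prop :=
  forall y, g y = 0 <-> exists x, f x = y.

Definition onto (A B : Type) (f : A -> B) : Prop := forall y, exists x, f x = y.

(* ... -> lo 1 -> lo 0 -> up 0 -> up 1 -> ..., exact at every term *)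
Definition exact_complex (lo up : nat -> zmodType)
    (dlo : forall n, lo n.+1 -> lo n) (dmid : lo 0%N -> up 0%N)
    (dup : forall n, up n -> up n.+1) : Prop :=
  [/\ forall n, exact_at (dlo n.+1) (dlo n),
      exact_at (dlo 0%N) dmid,
      exact_at dmid (dup 0%N)
    & forall n, exact_at (dup n) (dup n.+1)].

End Exactness.

(* Right R-modules are left modules over the converse ring R^c:
   r *: b stands for the right action b . r. *)
Section Tensor.
Context (R : pzRingType) (B : lmodType R^c) (M : lmodType R).

Inductive tens_rel : {freeg (B * M)} -> Prop :=
| TensRel0 : tens_rel 0
| TensRelB u v : tens_rel u -> tens_rel v -> tens_rel (u - v)
| TensRelDl b b' m :
    tens_rel (<< (b + b', m) >> - (<< (b, m) >> + << (b', m) >>))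
| TensRelDr b m m' :
    tens_rel (<< (b, m + m') >> - (<< (b, m) >> + << (b, m') >>))
| TensRelZ (r : R) b m :
    tens_rel (<< ((r : R^c) *: b, m) >> - << (b, r *: m) >>).

Definition tens_pred : {pred {freeg (B * M)}} := fun v => `[< tens_rel v >].

Lemma tens_pred_zmod_closed : zmod_closed tens_pred.
Proof.
split; first by apply/asboolP; exact: TensRel0.
by move=> u v /asboolP hu /asboolP hv; apply/asboolP; exact: TensRelB.
Qed.

HB.instance Definition _ :=
  GRing.isZmodClosed.Build {freeg (B * M)} tens_pred tens_pred_zmod_closed.

Definition tens_sub : zmodClosed {freeg (B * M)} := tens_pred.

Definition tens : zmodType := Quotient.quot tens_sub.

Definition tensor (b : B) (m : M) : tens :=
  \pi_(Quotient.quot tens_sub) << (b, m) >>.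

Lemma tensorDl b b' m : tensor (b + b') m = tensor b m + tensor b' m.
Proof.
rewrite /tensor -raddfD /=; apply/eqP; rewrite -Quotient.idealrBE.
by apply/asboolP; exact: TensRelDl.
Qed.

Lemma tensorDr b m m' : tensor b (m + m') = tensor b m + tensor b m'.
Proof.
rewrite /tensor -raddfD /=; apply/eqP; rewrite -Quotient.idealrBE.
by apply/asboolP; exact: TensRelDr.
Qed.

Lemma tensorZ (r : R) b m : tensor ((r : R^c) *: b) m = tensor b (r *: m).
Proof.
rewrite /tensor; apply/eqP; rewrite -Quotient.idealrBE.
by apply/asboolP; exact: TensRelZ.
Qed.

Definition balanced (A : zmodType) (phi : B -> M -> A) : Prop :=
  [/\ forall b b' m, phi (b + b') m = phi b m + phi b' m,
      forall b m m', phi b (m + m') = phi b m + phi b m'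
    & forall (r : R) b m, phi ((r : R^c) *: b) m = phi b (r *: m)].

(* The additive map sending b (x) m to phi b m; it only depends on the choice
   of representatives when phi is not balanced. *)
Definition tens_lift (A : zmodType) (phi : B -> M -> A) (t : tens) : A :=
  fglift (fun bm : B * M => phi bm.1 bm.2 : zmodule A) (repr t).

Section Lift.
Context (A : zmodType) (phi : B -> M -> A).
Hypothesis phi_bal : balanced phi.

Let lf : {freeg (B * M)} -> A :=
  fglift (fun bm : B * M => phi bm.1 bm.2 : zmodule A).

Let lfB u v : lf (u - v) = lf u - lf v.
Proof. exact: (@lift_is_additive _ _ (zmodule A) _ u v). Qed.

Let lfD u v : lf (u + v) = lf u + lf v.
Proof. by have := lfB (u + v) v; rewrite addrK => ->; rewrite subrK. Qed.

Let lfU b m : lf << (b, m) >> = phi b m.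
Proof. by rewrite /lf liftU scale1r. Qed.

Let lf_rel u : tens_rel u -> lf u = 0.
Proof.
have [hDl hDr hZ] := phi_bal.
elim=> [|{}u v _ hu _ hv|b b' m|b m m'|r b m].
- by have := lfB 0 0; rewrite !subrr.
- by rewrite lfB hu hv subrr.
- by rewrite lfB lfD !lfU hDl subrr.
- by rewrite lfB lfD !lfU hDr subrr.
- by rewrite lfB !lfU hZ subrr.
Qed.

Let tens_lift_pi u : tens_lift phi (\pi_(Quotient.quot tens_sub) u) = lf u.
Proof.
rewrite /tens_lift -/(lf _); apply/eqP; rewrite -subr_eq0 -lfB; apply/eqP.
apply: lf_rel; apply/asboolP.
by rewrite -[`[< _ >]]/(_ \in tens_sub) Quotient.idealrBE reprK.
Qed.

Lemma tens_liftE b m : tens_lift phi (tensor b m) = phi b m.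
Proof. by rewrite tens_lift_pi lfU. Qed.

Lemma tens_lift_is_zmod_morphism : zmod_morphism (tens_lift phi).
Proof.
move=> s t.
have piK (x : tens) : \pi_(Quotient.quot tens_sub) (repr x) = x by exact: reprK.
by rewrite -(piK s) -(piK t) -raddfB !tens_lift_pi lfB.
Qed.

End Lift.

End Tensor.

Section TensorMap.
Context (R : pzRingType) (B B' : lmodType R^c) (M M' : lmodType R).
Context (f : {linear B -> B'}) (g : {linear M -> M'}).

Lemma tens_map_balanced : balanced (fun b m => tensor (f b) (g m)).
Proof.
split=> *; first by rewrite linearD tensorDl.
  by rewrite linearD tensorDr.
by rewrite !linearZ tensorZ.
Qed.

Definition tens_map : tens B M -> tens B' M' :=
  tens_lift (fun b m => tensor (f b) (g m)).

Lemma tens_mapE b m : tens_map (tensor b m) = tensor (f b) (g m).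
Proof. exact: (tens_liftE tens_map_balanced). Qed.

HB.instance Definition _ :=
  GRing.isZmodMorphism.Build (tens B M) (tens B' M') tens_map
    (tens_lift_is_zmod_morphism tens_map_balanced).

End TensorMap.

Section Modules.
Context (R : pzRingType).

Definition injective_module (E : lmodType R) : Prop :=
  forall (A B : lmodType R) (f : {linear A -> B}) (g : {linear A -> E}),
    injective f -> exists h : {linear B -> E}, forall a, h (f a) = g a.

Definition flat_left (M : lmodType R) : Prop :=
  forall (A B C : lmodType R^c) (f : {linear A -> B}) (g : {linear B -> C}),
    exact_at f g ->
    exact_at (tens_map f (id_module M))
             (tens_map g (id_module M)).

Definition flat_right (M : lmodType R^c) : Prop :=
  forall (A B C : lmodType R) (f : {linear A -> B}) (g : {linear B -> C}),
    exact_at f g ->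
    exact_at (tens_map (id_module M) f)
             (tens_map (id_module M) g).

Definition closed_under_extensions (P : lmodType R -> Prop) : Prop :=
  forall (A E C : lmodType R) (f : {linear A -> E}) (g : {linear E -> C}),
    injective f -> exact_at f g -> onto g -> P A -> P C -> P E.

(* The sequence 0 -> G_k -> ... -> G_0 -> M -> 0 is padded with zero modules:
   G n = 0 for n > k. *)
Definition has_resolution (P : lmodType R -> Prop) (M : lmodType R) (k : nat)
    : Prop :=
  exists (G : nat -> lmodType R) (d : forall n, {linear G n.+1 -> G n})
         (eps : {linear G 0%N -> M}),
    [/\ forall n, (n <= k)%N -> P (G n),
        forall n, (k < n)%N -> forall x : G n, x = 0,
        onto eps,
        exact_at (d 0%N) eps
      & forall n, exact_at (d n.+1) (d n)].

(* Dimensions take values in nat extended by +oo, seen inside \bar int; the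
   infimum of an empty set of lengths is +oo. *)
Definition resolution_dim (P : lmodType R -> Prop) (M : lmodType R) : \bar int :=
  infimum +oo%E [set (k%:Z)%:E | k in [set k | has_resolution P M k]].

Definition class_resolution_dim (P X : lmodType R -> Prop) : \bar int :=
  supremum 0%E [set d | exists2 M, X M & d = resolution_dim P M].

End Modules.

Section GorensteinFlat.
Context (R : pzRingType).

(* iota is an isomorphism from G onto the kernel of up 0 -> up 1. *)
Definition Gorenstein_flat (B : lmodType R^c -> Prop) (G : lmodType R) : Prop :=
  exists (lo up : nat -> lmodType R)
         (dlo : forall n, {linear lo n.+1 -> lo n})
         (dmid : {linear lo 0%N -> up 0%N})
         (dup : forall n, {linear up n -> up n.+1}),
    [/\ forall n, flat_left (lo n) /\ flat_left (up n),
        exact_complex dlo dmid dup,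
        forall X, B X ->
          exact_complex (fun n => tens_map (id_module X) (dlo n))
                        (tens_map (id_module X) dmid)
                        (fun n => tens_map (id_module X) (dup n))
      & exists iota : {linear G -> up 0%N},
          injective iota /\ exact_at iota (dup 0%N)].

Definition fd_left (X : lmodType R -> Prop) : \bar int :=
  class_resolution_dim (@flat_left R) X.

Definition fd_right (X : lmodType R^c -> Prop) : \bar int :=
  class_resolution_dim (@flat_right R) X.

Definition Gfd (B : lmodType R^c -> Prop) (M : lmodType R) : \bar int :=
  resolution_dim (Gorenstein_flat B) M.

Definition lwGgl (B : lmodType R^c -> Prop) : \bar int :=
  supremum 0%E [set d | exists M, d = Gfd B M].

End GorensteinFlat.

(* Main.v *)
Require Import Defs.
From HB Require Import structures.
From mathcomp Require Import all_boot all_order all_algebra.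
From mathcomp Require Import generic_quotient ring_quotient.
From mathcomp Require Import boolp classical_sets functions constructive_ereal.
From mathcomp Require Import freeg.

Set Implicit Arguments.
Unset Strict Implicit.
Unset Printing Implicit Defensive.

Import Order.TTheory GRing.Theory Num.Theory.
Import Quotient.Exports.

Local Open Scope ring_scope.
Local Open Scope quotient_scope.

(** Everything is measured by the vanishing of Tor, in the form [tor_zero k X M]
    of Tor_(k+1)(X, M) = 0. Writing [Omega] for the kernel of a free cover, flat
    dimension at most [n] means that the [n]-th syzygy is flat, that is, that
    Tor_(n+1) vanishes against all modules of the other side. Two facts are used
    throughout: Tor may be computed from presentations of either factor, and it
    shifts its degree along short exact sequences; both come from one diagram
    chase, [snake_injective].

    Suppose that all left modules have Gorenstein flat dimension at most [n].
    A Gorenstein flat module has no higher Tor against the modules of the class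
    B, because its complex stays exact after tensoring with them; so a module
    with a Gorenstein flat resolution of length [n] has no Tor above degree [n]
    against B ([Gorenstein_resolution_tor_zero]), and fd(B) is at most [n]. For
    the injective modules, closure under extensions enters: by iterated pushouts,
    a module with such a resolution embeds into a module of flat dimension at
    most [n] ([Gorenstein_embedding]). An injective module is a direct summand of
    any module that contains it, hence has flat dimension at most [n] as well.

    Conversely, suppose that [n] bounds both fd(B) and the flat dimension of the
    injective left modules. Then the [n]-th syzygy of every left module is
    Gorenstein flat ([Omega_Gorenstein_flat]). On its left stands a free
    resolution. On its right, take an injective coresolution of the module and
    pass to [n]-th syzygies: by the horseshoe lemma this gives exact sequences,
    whose middle terms are [n]-th syzygies of injective modules, hence flat. The
    resulting complex stays exact after tensoring with a member of B, since all
    its kernels are [n]-th syzygies and fd(B) is at most [n]. With the free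
    modules in front this is a Gorenstein flat resolution of length [n].

    Injective modules enough for this exist as modules of additive maps from the
    ring to a divisible group ([enough_injectives]). *)

(** * Submodules, quotients and short exact sequences *)

Definition linear_of (R : pzRingType) (U V : lmodType R) (f : U -> V)
    (lin_f : linear f) : {linear U -> V} :=
  HB.pack f (GRing.isLinear.Build R U V *:%R f lin_f).

Lemma linear_ofE (R : pzRingType) (U V : lmodType R) (f : U -> V)
  (lin_f : linear f) : linear_of lin_f =1 f.
Proof. by []. Qed.

Record submodule (R : pzRingType) (M : lmodType R) := Submodule {
  in_submodule :> M -> Prop;
  submodule_zero : in_submodule 0;
  submodule_lin : forall a u v,
    in_submodule u -> in_submodule v -> in_submodule (a *: u + v) }.

Section SubmoduleTypes.
Context (R : pzRingType) (M : lmodType R) (S : submodule M).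

Definition submodule_pred : {pred M} := fun x => `[< S x >].

Lemma submodule_pred_closed : subsemimod_closed submodule_pred.
Proof.
have lin a u v : u \in submodule_pred -> v \in submodule_pred ->
    a *: u + v \in submodule_pred.
  by move=> /asboolP hu /asboolP hv; apply/asboolP; exact: submodule_lin.
have S0 : 0 \in submodule_pred by apply/asboolP; exact: submodule_zero.
split; first split=> // u v hu hv.
  by rewrite -[u]scale1r lin.
by move=> a u hu; rewrite -[_ *: _]addr0 lin.
Qed.

HB.instance Definition _ :=
  GRing.isSubmodClosed.Build R M submodule_pred submodule_pred_closed.

Definition submodule_type : Type := {x : M | submodule_pred x}.

HB.instance Definition _ := [isSub of submodule_type for @sval M submodule_pred].
HB.instance Definition _ := [Choice of submodule_type by <:].
HB.instance Definition _ := [SubChoice_isSubLmodule of submodule_type by <:].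

Definition incl : {linear submodule_type -> M} :=
  linear_of (f := val) (fun a u v => linearP val a u v).

Lemma incl_inj : injective incl. Proof. exact: val_inj. Qed.

Lemma inclP x : S (incl x). Proof. by have /asboolP := valP x. Qed.

Lemma incl_onto y : S y -> exists x, incl x = y.
Proof. by move=> /asboolP Sy; exists (Sub y Sy); rewrite linear_ofE SubK. Qed.

Definition quotient_type : Type := Quotient.quot submodule_pred.

HB.instance Definition _ := GRing.Zmodule.on quotient_type.

Let pi (x : M) : quotient_type := \pi_(Quotient.quot submodule_pred) x.

Let piK y : pi (repr y) = y. Proof. exact: reprK. Qed.

Let pi_eq x y : pi x = pi y <-> S (x - y).
Proof.
split=> [/eqP|h].
  by rewrite -Quotient.idealrBE => /asboolP.
by apply/eqP; rewrite -Quotient.idealrBE; apply/asboolP.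
Qed.

Let piD x y : pi (x + y) = pi x + pi y.
Proof. by rewrite /pi raddfD. Qed.

Let quotient_scale (a : R) (y : quotient_type) : quotient_type :=
  pi (a *: repr y).

Let scale_pi a x : quotient_scale a (pi x) = pi (a *: x).
Proof.
apply/pi_eq; rewrite -scalerBr -[_ *: _]addr0; apply: submodule_lin.
  by apply/pi_eq; rewrite piK.
exact: submodule_zero.
Qed.

Let scaleA a b y :
  quotient_scale a (quotient_scale b y) = quotient_scale (a * b) y.
Proof. by rewrite -(piK y) !scale_pi scalerA. Qed.
Let scale1 : left_id 1 quotient_scale.
Proof. by move=> y; rewrite -(piK y) scale_pi scale1r. Qed.
Let scaleDr : right_distributive quotient_scale +%R.
Proof.
by move=> a x y; rewrite -(piK x) -(piK y) -piD !scale_pi -piD scalerDr.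
Qed.
Let scaleDl y : {morph quotient_scale^~ y : a b / a + b}.
Proof. by move=> a b; rewrite -(piK y) !scale_pi -piD scalerDl. Qed.

HB.instance Definition _ :=
  GRing.Zmodule_isLmodule.Build R quotient_type scaleA scale1 scaleDr scaleDl.

Let pi_linear : linear pi.
Proof. by move=> a x y; rewrite piD -scale_pi. Qed.

Definition quotient_map : {linear M -> quotient_type} := linear_of pi_linear.

Lemma quotient_map_onto : onto quotient_map.
Proof. by move=> y; exists (repr y); exact: piK. Qed.

Lemma quotient_map_eq0 x : quotient_map x = 0 <-> S x.
Proof. by rewrite -(linear0 quotient_map) pi_eq subr0. Qed.

End SubmoduleTypes.

Definition short_exact (A B C : zmodType) (f : A -> B) (g : B -> C) : Prop :=
  [/\ injective f, exact_at f g & onto g].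

Section KernelsCokernels.
Context (R : pzRingType) (A B : lmodType R) (f : {linear A -> B}).

Definition ker_submodule : submodule A.
Proof.
exists (fun x => f x = 0); first exact: linear0.
by move=> a u v fu fv; rewrite linearP fu fv scaler0 addr0.
Defined.

Definition im_submodule : submodule B.
Proof.
exists (fun y => exists x, f x = y); first by exists 0; rewrite linear0.
by move=> a _ _ [u <-] [v <-]; exists (a *: u + v); rewrite linearP.
Defined.

Lemma ker_exact : exact_at (incl ker_submodule) f.
Proof.
move=> y; split=> [/(@incl_onto _ _ ker_submodule)//|[x <-]].
exact: (inclP (S := ker_submodule)).
Qed.

Lemma coker_exact : exact_at f (quotient_map im_submodule).
Proof. by move=> y; exact: (quotient_map_eq0 im_submodule). Qed.

Lemma exact_comp0 (C : zmodType) (g : B -> C) x : exact_at f g -> g (f x) = 0.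
Proof. by move=> ex; apply/ex; exists x. Qed.

End KernelsCokernels.

Lemma ker_short_exact (R : pzRingType) (A B : lmodType R) (f : {linear A -> B}) :
  onto f -> short_exact (incl (ker_submodule f)) f.
Proof.
by move=> sur; split; [exact: incl_inj | exact: ker_exact | exact: sur].
Qed.

Lemma coker_short_exact (R : pzRingType) (A B : lmodType R)
    (f : {linear A -> B}) :
  injective f -> short_exact f (quotient_map (im_submodule f)).
Proof.
move=> inj; split; first exact: inj.
  exact: coker_exact.
exact: quotient_map_onto.
Qed.

Section Factorization.
Context (R : pzRingType).

Lemma lift_injective (A B X : lmodType R) (f : {linear A -> B})
    (h : {linear X -> B}) :
  injective f -> (forall x, exists a, f a = h x) ->
  exists k : {linear X -> A}, forall x, f (k x) = h x.
Proof.
move=> inj_f /choice[k fk].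
have lin_k : linear k by move=> a u v; apply: inj_f; rewrite linearP !fk linearP.
by exists (linear_of lin_k).
Qed.

Lemma factor_onto (A B C : lmodType R) (p : {linear A -> B})
    (w : {linear A -> C}) :
  onto p -> (forall a, p a = 0 -> w a = 0) ->
  exists k : {linear B -> C}, forall a, k (p a) = w a.
Proof.
move=> /choice[s ps] kerp.
have wE a a' : p a = p a' -> w a = w a'.
  move=> paa'; apply/eqP; rewrite -subr_eq0 -linearB kerp //.
  by rewrite linearB /= paa' subrr.
have lin_k : linear (w \o s).
  by move=> a u v /=; rewrite -linearP; apply: wE; rewrite linearP !ps.
by exists (linear_of lin_k) => a /=; apply: wE; rewrite ps.
Qed.

Lemma bijective_inverse (A B : lmodType R) (f : {linear A -> B}) :
  injective f -> onto f ->
  exists k : {linear B -> A}, cancel f k /\ cancel k f.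
Proof.
move=> inj_f sur_f; have [k fk] := lift_injective (h := @idfun B) inj_f sur_f.
by exists k; split=> x //; apply: inj_f; rewrite fk.
Qed.

Lemma pair_lin (A B : lmodType R) a (x x' : A) (y y' : B) :
  a *: (x, y) + (x', y') = (a *: x + x', a *: y + y').
Proof. by []. Qed.

Lemma pair_sub (A B : zmodType) (x x' : A) (y y' : B) :
  (x, y) - (x', y') = (x - x', y - y').
Proof. by []. Qed.

(** Gluing two extensions along a common submodule [K]: the pushout [P] of [j]
    and [i] is the quotient of [H * G] by the antidiagonal copy of [K], and it
    is at once an extension of [D] by [H] and of [C] by [G]. *)
Lemma pushout (K H G C D : lmodType R) (j : {linear K -> H}) (q : {linear H -> C})
    (i : {linear K -> G}) (p : {linear G -> D}) :
  short_exact j q -> short_exact i p ->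
  exists (P : lmodType R) (a : {linear H -> P}) (p' : {linear P -> D})
    (b : {linear G -> P}) (q' : {linear P -> C}),
    short_exact a p' /\ short_exact b q'.
Proof.
move=> [inj_j ex_j sur_q] [inj_i ex_i sur_p].
have lin_d : linear (fun k => (j k, - i k)).
  by move=> a u v; rewrite pair_lin (linearP i) (linearP j) opprD scalerN.
pose d := linear_of lin_d; pose P := quotient_type (im_submodule d).
pose pi := quotient_map (im_submodule d).
have piP x : pi x = 0 <-> exists k, (j k, - i k) = x.
  exact: quotient_map_eq0.
have lin_a : linear (fun h => pi (h, 0)).
  move=> a u v; rewrite -linearP pair_lin.
  by rewrite scaler0 addr0.
have lin_b : linear (fun g => pi (0, g)).
  move=> a u v; rewrite -linearP pair_lin.
  by rewrite scaler0 addr0.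
have lin_p : linear (fun x : H * G => p x.2) by move=> a u v; rewrite linearP.
have lin_q : linear (fun x : H * G => q x.1) by move=> a u v; rewrite linearP.
have sur_pi : onto pi by exact: quotient_map_onto.
have [p' p'E] : exists k : {linear P -> D}, forall x, k (pi x) = p x.2.
  apply: (factor_onto (w := linear_of lin_p)) => // x /piP[k <-].
  by rewrite /= linearN; apply/eqP; rewrite oppr_eq0; apply/eqP/ex_i; exists k.
have [q' q'E] : exists k : {linear P -> C}, forall x, k (pi x) = q x.1.
  apply: (factor_onto (w := linear_of lin_q)) => // x /piP[k <-].
  by apply/ex_j; exists k.
exists P, (linear_of lin_a), p', (linear_of lin_b), q'; split; split.
- apply: raddf_inj => h /piP[k [<- /eqP]]; rewrite oppr_eq0 => /eqP ik0.
  by rewrite (inj_i k 0) ?linear0.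
- move=> y; split=> [|[h <-]]; last by rewrite p'E linear0.
  have [[h g] <-] := sur_pi y; rewrite p'E => /ex_i[k /= <-].
  exists (h + j k); rewrite -[LHS]/(pi (h + j k, 0)).
  apply/eqP; rewrite -subr_eq0 -(linearB pi); apply/eqP/piP.
  by exists k; rewrite pair_sub sub0r addrAC subrr add0r.
- by move=> x; have [g <-] := sur_p x; exists (pi (0, g)); rewrite p'E.
- apply: raddf_inj => g /piP[k [jk0 <-]].
  by rewrite (inj_j k 0) ?linear0 // oppr0.
- move=> y; split=> [|[g <-]]; last by rewrite q'E linear0.
  have [[h g] <-] := sur_pi y; rewrite q'E => /ex_j[k /= <-].
  exists (g + i k); rewrite -[LHS]/(pi (0, g + i k)).
  apply/eqP; rewrite -subr_eq0 -(linearB pi); apply/eqP/piP.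
  exists (- k); rewrite !linearN opprK.
  by rewrite pair_sub sub0r addrAC subrr add0r.
- by move=> x; have [h <-] := sur_q x; exists (pi (h, 0)); rewrite q'E.
Qed.

End Factorization.

(** * Free modules *)

Lemma sum_support (V : nmodType) (K : eqType) (s t : seq K) (F : K -> V) :
  uniq s -> uniq t -> {subset s <= t} -> (forall k, k \notin s -> F k = 0) ->
  \sum_(k <- t) F k = \sum_(k <- s) F k.
Proof.
move=> us ut st F0; rewrite -(@big_rmcond_in _ _ _ _ t (fun k => k \in s)).
  2: by move=> k _; exact: F0.
rewrite -big_filter; apply/perm_big/uniq_perm => //; first exact: filter_uniq.
by move=> k; rewrite mem_filter; case: (boolP (k \in s)) => //= /st ->.
Qed.

Section FreeModule.
Context (R : pzRingType) (K : choiceType).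

Definition finite_support_submodule : submodule (K -> R^o).
Proof.
exists (fun f => exists s : seq K, forall k, k \notin s -> f k = 0).
  by exists [::].
move=> a u v [s us] [t vt]; exists (s ++ t) => k; rewrite mem_cat negb_or.
move=> /andP[/us uk /vt vk].
by rewrite /= [LHS]/(a * u k + v k) uk vk mulr0; exact: addr0.
Defined.

(** The finitely supported functions on [K]; keeping the coordinates visible is
    what makes the flatness of these modules a computation. *)
Definition free_module : lmodType R := submodule_type finite_support_submodule.

Definition free_coord (x : free_module) (k : K) : R := incl _ x k.

Lemma free_coord_lin k a x y :
  free_coord (a *: x + y) k = a * free_coord x k + free_coord y k.
Proof. by rewrite /free_coord linearP. Qed.

Lemma free_coordD k x y : free_coord (x + y) k = free_coord x k + free_coord y k.
Proof. by rewrite /free_coord linearD. Qed.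

Lemma free_coordZ k a x : free_coord (a *: x) k = a * free_coord x k.
Proof. by rewrite /free_coord linearZ. Qed.

Lemma free_coord0 k : free_coord 0 k = 0.
Proof. by rewrite /free_coord linear0. Qed.

Lemma free_coord_sum k (I : Type) (r : seq I) (F : I -> free_module) :
  free_coord (\sum_(i <- r) F i) k = \sum_(i <- r) free_coord (F i) k.
Proof.
by elim/big_rec2: _ => [|i y x _ <-]; rewrite ?free_coord0 ?free_coordD.
Qed.

Lemma free_ext x y : free_coord x =1 free_coord y -> x = y.
Proof. by move=> xy; apply: incl_inj; apply/funext => k; exact: xy. Qed.

Lemma free_gen_exists k :
  exists e : free_module, forall j, free_coord e j = (k == j)%:R.
Proof.
have [|e ee] := incl_onto (S := finite_support_submodule)
    (y := fun j => (k == j)%:R).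
  by exists [:: k] => j; rewrite inE eq_sym => /negbTE ->.
by exists e => j; rewrite /free_coord ee.
Qed.

Definition free_gen k : free_module := sval (cid (free_gen_exists k)).

Lemma free_coord_gen k j : free_coord (free_gen k) j = (k == j)%:R.
Proof. exact: (svalP (cid (free_gen_exists k))). Qed.

Lemma free_support_exists (x : free_module) :
  exists s, uniq s /\ (forall k, k \notin s -> free_coord x k = 0).
Proof.
have [s xs] := inclP x; exists (undup s).
by split=> [|k]; [exact: undup_uniq | rewrite mem_undup => /xs].
Qed.

Definition free_support x : seq K := sval (cid (free_support_exists x)).

Lemma free_support_uniq x : uniq (free_support x).
Proof. by have [] := svalP (cid (free_support_exists x)). Qed.

Lemma free_coord_out x k : k \notin free_support x -> free_coord x k = 0.
Proof. by have [_] := svalP (cid (free_support_exists x)); exact. Qed.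

Lemma free_expand x s : uniq s -> {subset free_support x <= s} ->
  x = \sum_(k <- s) free_coord x k *: free_gen k.
Proof.
move=> us xs; apply: free_ext => j; rewrite free_coord_sum.
have [js|js] := boolP (j \in s); last first.
  rewrite free_coord_out; last by apply: contra js => /xs.
  rewrite big_seq big1 // => k ks; rewrite free_coordZ free_coord_gen.
  have [kj|_] := eqVneq k j; last by rewrite mulr0.
  by rewrite -kj ks in js.
rewrite (bigD1_seq j) //= big1 ?addr0.
  by rewrite free_coordZ free_coord_gen eqxx mulr1.
by move=> k /negbTE kj; rewrite free_coordZ free_coord_gen kj mulr0.
Qed.

Lemma free_universal (M : lmodType R) (f : K -> M) :
  exists phi : {linear free_module -> M}, forall k, phi (free_gen k) = f k.
Proof.
pose phi x := \sum_(k <- free_support x) free_coord x k *: f k.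
have phiE x s : uniq s -> {subset free_support x <= s} ->
    phi x = \sum_(k <- s) free_coord x k *: f k.
  move=> us xs; apply/esym/sum_support => //; first exact: free_support_uniq.
  by move=> k /free_coord_out ->; rewrite scale0r.
have lin : linear phi.
  move=> a x y.
  set s := undup (free_support x ++ free_support y ++ free_support (a *: x + y)).
  have us : uniq s by exact: undup_uniq.
  rewrite !(phiE _ s us) => [|k|k|k];
    try by rewrite mem_undup !mem_cat => ->; rewrite ?orbT.
  rewrite scaler_sumr -big_split; apply: eq_bigr => k _.
  by rewrite free_coord_lin scalerDl scalerA.
exists (linear_of lin) => k.
have [uk|uk] := boolP (k \in free_support (free_gen k)).
  rewrite linear_ofE /phi (bigD1_seq k) ?free_support_uniq //= big1 => [|j jk].
    by rewrite addr0 free_coord_gen eqxx scale1r.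
  by rewrite free_coord_gen eq_sym (negbTE jk) scale0r.
have R0 (r : R) : r = 0.
  (* The generator can only miss its own support over the zero ring. *)
  have e : 1 = 0 :> R.
    by move: (free_coord_out uk); rewrite free_coord_gen eqxx.
  by rewrite -[r]mulr1 e mulr0.
rewrite -[f k]scale1r (R0 1) scale0r linear_ofE /phi big1 // => j _.
by rewrite (R0 (free_coord _ _)) scale0r.
Qed.

Lemma free_linear_ext (M : lmodType R) (f g : {linear free_module -> M}) :
  (forall k, f (free_gen k) = g (free_gen k)) -> f =1 g.
Proof.
move=> fg x; have e := free_expand (free_support_uniq x) (fun k h => h).
rewrite e !linear_sum.
by apply: eq_bigr => k _; rewrite !linearZ fg.
Qed.

Lemma free_projective (E C : lmodType R) (g : {linear E -> C})
    (q : {linear free_module -> C}) :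
  onto g -> exists q' : {linear free_module -> E}, forall x, g (q' x) = q x.
Proof.
move=> /choice[s gs].
have [q' q'E] := free_universal (s \o q \o free_gen).
exists q'; apply: (free_linear_ext (f := g \o q')) => k.
by rewrite /= q'E /= gs.
Qed.

End FreeModule.

Section FreeCover.
Context (R : pzRingType) (M : lmodType R).

(** The cover with one generator per element of [M]. Fixing one cover for every
    module makes the syzygy a function of the module, which can be iterated. *)
Definition free_cover : {linear free_module R M -> M} :=
  sval (cid (free_universal (R := R) (fun m : M => m))).

Lemma free_cover_onto : onto free_cover.
Proof.
by move=> m; exists (free_gen R m); exact: (svalP (cid (free_universal _)) m).
Qed.

Definition Omega : lmodType R := submodule_type (ker_submodule free_cover).

Definition Omega_incl : {linear Omega -> free_module R M} :=
  incl (ker_submodule free_cover).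

Lemma Omega_short_exact : short_exact Omega_incl free_cover.
Proof. exact: ker_short_exact free_cover_onto. Qed.

End FreeCover.

(** * Tensor products *)

Section TensorBasics.
Context (R : pzRingType) (B : lmodType R^c) (M : lmodType R).

Lemma tens_ind (P : tens B M -> Prop) :
  (forall t u, P t -> P u -> P (t - u)) -> (forall b m, P (tensor b m)) ->
  forall t, P t.
Proof.
move=> PB Pgen t.
have P0 : P 0 by rewrite -(subrr (tensor 0 0)); exact: PB.
have PN u : P u -> P (- u) by move=> Pu; rewrite -sub0r; exact: PB.
have PD u v : P u -> P v -> P (u + v).
  by move=> Pu Pv; rewrite -[v]opprK; apply: PB => //; exact: PN.
have <- : \pi_(Quotient.quot (tens_sub B M)) (repr t) = t by exact: reprK.
rewrite -[repr t]freeg_sumE raddf_sum /=.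
elim/big_ind: _ => // -[b m] _.
have -> (z : int) : << z *g (b, m) >> = << (b, m) >> *~ z.
  by rewrite freegU_mulz intz.
have Pn n : P (\pi_(Quotient.quot (tens_sub B M)) (<< (b, m) >> *+ n)).
  rewrite raddfMn /=; elim: n => [|n IH]; rewrite ?mulr0n // mulrS.
  by apply: PD => //; exact: Pgen.
case: (coeff _ _) => n; first by rewrite -pmulrn.
by rewrite NegzE mulrNz -pmulrn raddfN; apply: PN; exact: Pn.
Qed.

Lemma tens_additive_ext (A : zmodType) (F G : {additive tens B M -> A}) :
  (forall b m, F (tensor b m) = G (tensor b m)) -> F =1 G.
Proof. by move=> FG; elim/tens_ind => [t u|//]; rewrite !raddfB /= => -> ->. Qed.

Lemma tens_universal (A : zmodType) (phi : B -> M -> A) : balanced phi ->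
  exists F : {additive tens B M -> A}, forall b m, F (tensor b m) = phi b m.
Proof.
move=> bal; pose F : {additive tens B M -> A} :=
  HB.pack (tens_lift phi) (GRing.isZmodMorphism.Build (tens B M) A
    (tens_lift phi) (tens_lift_is_zmod_morphism bal)).
by exists F => b m; exact: (tens_liftE bal).
Qed.

Lemma tensor0l (m : M) : tensor (0 : B) m = 0.
Proof. by apply: (addrI (tensor 0 m)); rewrite -tensorDl !addr0. Qed.

Lemma tensor0r (b : B) : tensor b (0 : M) = 0.
Proof. by apply: (addrI (tensor b 0)); rewrite -tensorDr !addr0. Qed.

Lemma tensorBl (b b' : B) (m : M) : tensor (b - b') m = tensor b m - tensor b' m.
Proof. by apply: (addIr (tensor b' m)); rewrite -tensorDl !subrK. Qed.

Lemma tensorBr (b : B) (m m' : M) : tensor b (m - m') = tensor b m - tensor b m'.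
Proof. by apply: (addIr (tensor b m')); rewrite -tensorDr !subrK. Qed.

Lemma tensor_suml (I : Type) (r : seq I) (F : I -> B) (m : M) :
  tensor (\sum_(i <- r) F i) m = \sum_(i <- r) tensor (F i) m.
Proof. by elim/big_rec2: _ => [|i y x _ <-]; rewrite ?tensor0l ?tensorDl. Qed.

Lemma tensor_sumr (I : Type) (r : seq I) (b : B) (F : I -> M) :
  tensor b (\sum_(i <- r) F i) = \sum_(i <- r) tensor b (F i).
Proof. by elim/big_rec2: _ => [|i y x _ <-]; rewrite ?tensor0r ?tensorDr. Qed.

End TensorBasics.

Section TensorFunctor.
Context (R : pzRingType).

Lemma tens_map_comp (B B' B'' : lmodType R^c) (M M' M'' : lmodType R)
    (f : {linear B -> B'}) (g : {linear M -> M'})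
    (f' : {linear B' -> B''}) (g' : {linear M' -> M''})
    (f'' : {linear B -> B''}) (g'' : {linear M -> M''}) :
  (forall b, f' (f b) = f'' b) -> (forall m, g' (g m) = g'' m) ->
  forall t, tens_map f' g' (tens_map f g t) = tens_map f'' g'' t.
Proof.
move=> fE gE; elim/tens_ind => [t u|b m]; first by rewrite !raddfB /= => -> ->.
by rewrite !tens_mapE fE gE.
Qed.

Lemma tens_map_id (B : lmodType R^c) (M : lmodType R) (f : {linear B -> B})
    (g : {linear M -> M}) :
  f =1 id -> g =1 id -> tens_map f g =1 id.
Proof.
move=> fE gE; elim/tens_ind => [t u|b m]; first by rewrite raddfB /= => -> ->.
by rewrite tens_mapE fE gE.
Qed.

Lemma tens_map_square (B B' : lmodType R^c) (M M' : lmodType R)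
    (f : {linear B -> B'}) (g : {linear M -> M'}) t :
  tens_map f (id_module M') (tens_map (id_module B) g t) =
  tens_map (id_module B') g (tens_map f (id_module M) t).
Proof.
rewrite (tens_map_comp (f'' := f) (g'' := g)) //.
by rewrite (tens_map_comp (f'' := f) (g'' := g)).
Qed.

Lemma tens_map_eq0 (B B' : lmodType R^c) (M M' : lmodType R)
    (f : {linear B -> B'}) (g : {linear M -> M'}) t :
  (forall b, f b = 0) \/ (forall m, g m = 0) -> tens_map f g t = 0.
Proof.
move=> fg0; elim/tens_ind: t => [t u|b m].
  by rewrite raddfB /= => -> ->; rewrite subrr.
by rewrite tens_mapE; case: fg0 => ->; rewrite ?tensor0l ?tensor0r.
Qed.

Lemma tens_map_onto (B B' : lmodType R^c) (M M' : lmodType R)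
    (f : {linear B -> B'}) (g : {linear M -> M'}) :
  onto f -> onto g -> onto (tens_map f g).
Proof.
move=> sf sg; elim/tens_ind => [t u [x <-] [y <-]|b m].
  by exists (x - y); rewrite raddfB.
have [x <-] := sf b; have [y <-] := sg m.
by exists (tensor x y); rewrite tens_mapE.
Qed.

Lemma zmod_quotient_exists (V : zmodType) (S : V -> Prop) :
  S 0 -> (forall x y, S x -> S y -> S (x - y)) ->
  exists (Q : zmodType) (q : {additive V -> Q}),
    onto q /\ forall x, q x = 0 <-> S x.
Proof.
move=> S0 SB; pose S' : V -> bool := fun x => `[< S x >].
have cl : zmod_closed S'.
  split; first exact/asboolP.
  by move=> x y /asboolP Sx /asboolP Sy; apply/asboolP; exact: SB.
pose Sc : zmodClosed V := HB.pack S' (GRing.isZmodClosed.Build V S' cl).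
pose q : {additive V -> Quotient.quot Sc} := \pi_(Quotient.quot Sc).
exists (Quotient.quot Sc), q; split=> [y|x].
  by exists (repr y); exact: reprK.
rewrite -(raddf0 q) -[X in _ <-> S X]subr0; split=> [/eqP|h].
  by rewrite -Quotient.idealrBE => /asboolP.
by apply/eqP; rewrite -Quotient.idealrBE; apply/asboolP.
Qed.

(** Right exactness in both variables at once. Modulo the two images, the class
    of [b (x) m] depends only on [g b] and [h m], so the quotient map factors
    through the tensor product of the two cokernels. *)
Lemma tens_map_kernel (A B C : lmodType R^c) (K M N : lmodType R)
    (f : {linear A -> B}) (g : {linear B -> C})
    (k : {linear K -> M}) (h : {linear M -> N}) :
  exact_at f g -> onto g -> exact_at k h -> onto h ->
  forall t, tens_map g h t = 0 -> exists a b,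
    t = tens_map f (id_module M) a + tens_map (id_module B) k b.
Proof.
move=> ex_g /choice[sg gsg] ex_h /choice[sh hsh].
pose S (t : tens B M) := exists a b,
  t = tens_map f (id_module M) a + tens_map (id_module B) k b.
have [||Q [q [_ qS]]] := @zmod_quotient_exists _ S.
- by exists 0, 0; rewrite !raddf0 addr0.
- move=> _ _ [a [b ->]] [a' [b' ->]]; exists (a - a'), (b - b').
  by rewrite !raddfB addrACA opprD.
have qE b b' m m' : g b = g b' -> h m = h m' ->
    q (tensor b m) = q (tensor b' m').
  move=> gbb' hmm'; apply/eqP; rewrite -subr_eq0 -raddfB; apply/eqP/qS.
  have [|a fa] := (ex_g (b - b')).1; first by rewrite linearB /= gbb' subrr.
  have [|x kx] := (ex_h (m - m')).1; first by rewrite linearB /= hmm' subrr.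
  exists (tensor a m), (tensor b' x).
  by rewrite !tens_mapE fa kx /= tensorBl tensorBr addrA subrK.
(* The sections [sg] and [sh] are mere functions; [qE] makes up for it. *)
have bal : balanced (fun c n => q (tensor (sg c) (sh n))).
  split=> [c c' n|c n n'|r c n].
  - by rewrite -raddfD -tensorDl; apply: qE; rewrite // linearD !gsg.
  - by rewrite -raddfD -tensorDr; apply: qE; rewrite // linearD !hsh.
  - rewrite (qE _ ((r : R^c) *: sg c) _ (sh n)) ?gsg ?linearZ ?gsg // tensorZ.
    by apply: qE; rewrite // linearZ !hsh.
have [F FE] := tens_universal bal.
have FqE t : F (tens_map g h t) = q t.
  apply: (tens_additive_ext (F := F \o tens_map g h)) => b m.
  by rewrite /= tens_mapE FE; apply: qE; rewrite ?gsg ?hsh.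
by move=> t t0; apply/qS; rewrite -FqE t0 raddf0.
Qed.

Lemma tens_right_exactl (A B C : lmodType R^c) (M : lmodType R)
    (f : {linear A -> B}) (g : {linear B -> C}) :
  exact_at f g -> onto g ->
  exact_at (tens_map f (id_module M)) (tens_map g (id_module M)).
Proof.
move=> ex_g sur_g t; split=> [t0|[x <-]]; last first.
  rewrite (tens_map_comp (f'' := \0) (g'' := id_module M)) //.
    by apply: tens_map_eq0; left.
  by move=> a; apply: exact_comp0.
have ex0 : exact_at (\0 : {linear M -> M}) (id_module M).
  by move=> m; split=> [m0|[y <-]] //; exists 0.
have sur1 : onto (id_module M) by move=> m; exists m.
have [a [b ->]] := tens_map_kernel ex_g sur_g ex0 sur1 t0.
by exists a; rewrite (tens_map_eq0 b) ?addr0 //; right.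
Qed.

Lemma tens_right_exactr (B : lmodType R^c) (K M N : lmodType R)
    (k : {linear K -> M}) (h : {linear M -> N}) :
  exact_at k h -> onto h ->
  exact_at (tens_map (id_module B) k) (tens_map (id_module B) h).
Proof.
move=> ex_h sur_h t; split=> [t0|[x <-]]; last first.
  rewrite (tens_map_comp (f'' := id_module B) (g'' := \0)) //.
    by apply: tens_map_eq0; right.
  by move=> a; apply: exact_comp0.
have ex0 : exact_at (\0 : {linear B -> B}) (id_module B).
  by move=> m; split=> [m0|[y <-]] //; exists 0.
have sur1 : onto (id_module B) by move=> m; exists m.
have [a [b ->]] := tens_map_kernel ex0 sur1 ex_h sur_h t0.
by exists b; rewrite (tens_map_eq0 a) ?add0r //; left.
Qed.

End TensorFunctor.

(** * Vanishing of Tor_1 and flatness *)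

(** The one diagram chase behind all dimension shifting: applied to a 3 by 3
    diagram and to its transpose, it carries injectivity back and forth between
    the last column [u3] and the last row [c1]. *)
Lemma snake_injective (A1 A2 A3 B1 B2 B3 C1 C2 : zmodType)
    (a1 : {additive A1 -> A2}) (a2 : {additive A2 -> A3})
    (b1 : {additive B1 -> B2}) (b2 : {additive B2 -> B3})
    (c1 : {additive C1 -> C2})
    (u1 : {additive A1 -> B1}) (u2 : {additive A2 -> B2})
    (u3 : {additive A3 -> B3})
    (v1 : {additive B1 -> C1}) (v2 : {additive B2 -> C2}) :
  exact_at a1 a2 -> onto a2 -> exact_at b1 b2 -> exact_at u1 v1 ->
  exact_at u2 v2 ->
  (forall x, b1 (u1 x) = u2 (a1 x)) -> (forall x, u3 (a2 x) = b2 (u2 x)) ->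
  (forall x, c1 (v1 x) = v2 (b1 x)) ->
  injective u2 -> injective c1 -> injective u3.
Proof.
move=> ex_a sur_a ex_b ex_1 ex_2 sq1 sq2 sq3 inj2 injc; apply: raddf_inj => t.
have [g <-] := sur_a t; rewrite sq2 => /ex_b[l lE].
have /ex_1[n nE] : v1 l = 0.
  by apply: injc; rewrite sq3 lE raddf0; apply/ex_2; exists g.
have -> : g = a1 n by apply: inj2; rewrite -sq1 nE.
by apply/ex_a; exists n.
Qed.

Section Tor1.
Context (R : pzRingType).

Section TwoSequences.
Context (N L X : lmodType R^c) (i : {linear N -> L}) (p : {linear L -> X}).
Context (K P M : lmodType R) (f : {linear K -> P}) (g : {linear P -> M}).
Hypotheses (ses_p : short_exact i p) (ses_g : short_exact f g).

(** Together with [tens_injective_left] this is the balance of Tor_1: for a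
    presentation of each factor, the injectivity of [N (x) M -> L (x) M] and that
    of [X (x) K -> X (x) P] imply each other when the middle terms [L] and [P]
    preserve the two injections. *)
Lemma tens_injective_right :
  injective (tens_map i (id_module M)) -> injective (tens_map (id_module L) f) ->
  injective (tens_map (id_module X) f).
Proof.
have [inj_i ex_p sur_p] := ses_p; have [inj_f ex_g sur_g] := ses_g.
move=> injM injL; move: injL injM.
apply: (snake_injective (a1 := tens_map i (id_module K))
  (a2 := tens_map p (id_module K)) (b1 := tens_map i (id_module P))
  (b2 := tens_map p (id_module P)) (u1 := tens_map (id_module N) f)
  (v1 := tens_map (id_module N) g) (v2 := tens_map (id_module L) g)) => //=.
- exact: tens_right_exactl.
- by apply: tens_map_onto => // x; exists x.
- exact: tens_right_exactl.
- exact: tens_right_exactr.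
- exact: tens_right_exactr.
all: by move=> x; rewrite tens_map_square.
Qed.

Lemma tens_injective_left :
  injective (tens_map (id_module X) f) -> injective (tens_map i (id_module P)) ->
  injective (tens_map i (id_module M)).
Proof.
have [inj_i ex_p sur_p] := ses_p; have [inj_f ex_g sur_g] := ses_g.
move=> injX injP; move: injP injX.
apply: (snake_injective (a1 := tens_map (id_module N) f)
  (a2 := tens_map (id_module N) g) (b1 := tens_map (id_module L) f)
  (b2 := tens_map (id_module L) g) (u1 := tens_map i (id_module K))
  (v1 := tens_map p (id_module K)) (v2 := tens_map p (id_module P))) => //=.
- exact: tens_right_exactr.
- by apply: tens_map_onto => // x; exists x.
- exact: tens_right_exactr.
- exact: tens_right_exactl.
- exact: tens_right_exactl.
all: by move=> x; rewrite tens_map_square.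
Qed.

End TwoSequences.

Definition preserves_injections_left (M : lmodType R) : Prop :=
  forall (A B : lmodType R^c) (f : {linear A -> B}),
    injective f -> injective (tens_map f (id_module M)).

Definition preserves_injections_right (X : lmodType R^c) : Prop :=
  forall (K P : lmodType R) (f : {linear K -> P}),
    injective f -> injective (tens_map (id_module X) f).

(** An element of [A (x) R^(K)] is determined by its [K]-indexed coordinates in
    [A], and a map [f] acts on the coordinates one by one. *)
Lemma free_preserves_left (K : choiceType) :
  preserves_injections_left (free_module R K).
Proof.
have coord_exists (A : lmodType R^c) :
    exists c : {additive tens A (free_module R K) -> (K -> A)},
      forall a l k, c (tensor a l) k = (free_coord l k : R^c) *: a.
  have [|c cE] := @tens_universal R A (free_module R K) (K -> A)
      (fun a l k => (free_coord l k : R^c) *: a).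
    split=> [a a' l|a l l'|r a l]; apply/funext => k.
    - exact: scalerDr.
    - by rewrite free_coordD; exact: scalerDl.
    - by rewrite free_coordZ scalerA.
  by exists c => a l k; rewrite cE.
move=> A B f inj_f.
have [cA cAE] := coord_exists A; have [cB cBE] := coord_exists B.
have nat k t : cB (tens_map f (id_module _) t) k = f (cA t k).
  elim/tens_ind: t => [t u|a l]; last by rewrite tens_mapE cBE cAE linearZ.
  by move=> ht hu; rewrite !raddfB [LHS]/(cB _ k - cB _ k) ht hu.
(* The support is allowed to grow so that two expansions can be subtracted. *)
have expand t : exists s : seq K, forall s', uniq s' -> {subset s <= s'} ->
    t = \sum_(k <- s') tensor (cA t k) (free_gen R k).
  elim/tens_ind: t => [t u [s hs] [s' hs']|a l].
    exists (s ++ s') => s'' us ss; rewrite {1}(hs s'') => [||k ks] //; last first.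
      by apply: ss; rewrite mem_cat ks.
    rewrite {1}(hs' s'') => [||k ks] //; last first.
      by apply: ss; rewrite mem_cat ks orbT.
    rewrite -sumrB; apply: eq_bigr => k _; rewrite -tensorBl raddfB.
    by [].
  exists (free_support l) => s' us ss.
  have e := free_expand us ss.
  rewrite {1}e tensor_sumr; apply: eq_bigr => k _.
  by rewrite cAE tensorZ.
apply: raddf_inj => t t0; have [s hs] := expand t.
rewrite (hs (undup s)) ?undup_uniq // => [|k]; last by rewrite mem_undup.
rewrite big1 // => k _.
suff -> : cA t k = 0 by rewrite tensor0l.
by apply: inj_f; rewrite linear0 -nat t0 raddf0.
Qed.

Lemma free_preserves_right (K : choiceType) :
  preserves_injections_right (free_module R^c K).
Proof.
have coord_exists (M : lmodType R) :
    exists c : {additive tens (free_module R^c K) M -> (K -> M)},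
      forall l m k, c (tensor l m) k = (free_coord l k : R) *: m.
  have [|c cE] := @tens_universal R (free_module R^c K) M (K -> M)
      (fun l m k => (free_coord l k : R) *: m).
    split=> [l l' m|l m m'|r l m]; apply/funext => k.
    - by rewrite free_coordD; exact: scalerDl.
    - exact: scalerDr.
    - by rewrite free_coordZ scalerA.
  by exists c => l m k; rewrite cE.
move=> M P f inj_f.
have [cM cME] := coord_exists M; have [cP cPE] := coord_exists P.
have nat k t : cP (tens_map (id_module _) f t) k = f (cM t k).
  elim/tens_ind: t => [t u|l m]; last by rewrite tens_mapE cPE cME linearZ.
  by move=> ht hu; rewrite !raddfB [LHS]/(cP _ k - cP _ k) ht hu.
have expand t : exists s : seq K, forall s', uniq s' -> {subset s <= s'} ->
    t = \sum_(k <- s') tensor (free_gen R^c k) (cM t k).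
  elim/tens_ind: t => [t u [s hs] [s' hs']|l m].
    exists (s ++ s') => s'' us ss; rewrite {1}(hs s'') => [||k ks] //; last first.
      by apply: ss; rewrite mem_cat ks.
    rewrite {1}(hs' s'') => [||k ks] //; last first.
      by apply: ss; rewrite mem_cat ks orbT.
    rewrite -sumrB; apply: eq_bigr => k _; rewrite -tensorBr raddfB.
    by [].
  exists (free_support l) => s' us ss.
  have e := free_expand us ss.
  rewrite {1}e tensor_suml; apply: eq_bigr => k _.
  by rewrite cME tensorZ.
apply: raddf_inj => t t0; have [s hs] := expand t.
rewrite (hs (undup s)) ?undup_uniq // => [|k]; last by rewrite mem_undup.
rewrite big1 // => k _.
suff -> : cM t k = 0 by rewrite tensor0r.
by apply: inj_f; rewrite linear0 -nat t0 raddf0.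
Qed.

(** Stands for Tor_1(X, M) = 0: for a flat [P] the kernel of the map in question
    is Tor_1(X, M), and in general it is a quotient of it, so that asking for
    all presentations or for one flat presentation is the same. *)
Definition tor1_zero (X : lmodType R^c) (M : lmodType R) : Prop :=
  forall (K P : lmodType R) (f : {linear K -> P}) (g : {linear P -> M}),
    short_exact f g -> injective (tens_map (id_module X) f).

(** The same group computed from a presentation of the other factor. *)
Lemma tor1_zero_injective_left (N L X : lmodType R^c) (i : {linear N -> L})
    (p : {linear L -> X}) (M : lmodType R) :
  short_exact i p -> tor1_zero X M -> injective (tens_map i (id_module M)).
Proof.
move=> ses_p tz; apply: (tens_injective_left ses_p (Omega_short_exact M)).
  exact: tz (Omega_short_exact M).
by apply: free_preserves_left; case: ses_p.
Qed.

(** A single presentation whose middle term is flat decides the vanishing. *)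
Lemma tor1_zero_of_left (N L X : lmodType R^c) (i : {linear N -> L})
    (p : {linear L -> X}) (M : lmodType R) :
  short_exact i p -> preserves_injections_right L ->
  injective (tens_map i (id_module M)) -> tor1_zero X M.
Proof.
move=> ses_p flatL inj_i K P f g ses_g.
apply: (tens_injective_right ses_p ses_g inj_i); apply: flatL.
by case: ses_g.
Qed.

Lemma tor1_zero_of_right (X : lmodType R^c) (K P M : lmodType R)
    (f : {linear K -> P}) (g : {linear P -> M}) :
  short_exact f g -> preserves_injections_left P ->
  injective (tens_map (id_module X) f) -> tor1_zero X M.
Proof.
move=> ses_g flatP inj_f.
have ses_X := Omega_short_exact X.
apply: (tor1_zero_of_left ses_X); first exact: free_preserves_right.
apply: (tens_injective_left ses_X ses_g inj_f); apply: flatP.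
by case: ses_X.
Qed.

Lemma preserves_leftP (M : lmodType R) :
  preserves_injections_left M <-> forall X, tor1_zero X M.
Proof.
split=> [flatM X | tz A B f inj_f].
  have ses_X := Omega_short_exact X.
  apply: (tor1_zero_of_left ses_X); first exact: free_preserves_right.
  by apply: flatM; case: ses_X.
exact: tor1_zero_injective_left (coker_short_exact inj_f) (tz _).
Qed.

Lemma preserves_rightP (X : lmodType R^c) :
  preserves_injections_right X <-> forall M, tor1_zero X M.
Proof.
split=> [flatX M | tz K P f inj_f].
  have ses_M := Omega_short_exact M.
  apply: (tor1_zero_of_right ses_M); first exact: free_preserves_left.
  by apply: flatX; case: ses_M.
exact: tz (coker_short_exact inj_f).
Qed.

Lemma exact0_injective (S : pzRingType) (A B : lmodType S) (f : {linear A -> B}) :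
  injective f -> exact_at (\0 : {linear A -> A}) f.
Proof.
move=> inj_f x; split=> [fx|[y <-]]; last exact: linear0.
by exists 0; apply: inj_f; rewrite fx linear0.
Qed.

Lemma image_factorization (S : pzRingType) (B C : lmodType S)
    (g : {linear B -> C}) :
  exists (I : lmodType S) (q : {linear B -> I}) (i : {linear I -> C}),
    [/\ onto q, injective i & forall x, i (q x) = g x].
Proof.
pose i := incl (im_submodule g).
have inj_i : injective i by exact: incl_inj.
have [q qE] : exists q : {linear B -> submodule_type (im_submodule g)},
    forall x, i (q x) = g x.
  apply: lift_injective => // x.
  by apply: (incl_onto (S := im_submodule g)); exists x.
exists (submodule_type (im_submodule g)), q, i; split=> // y.
have [x xE] := inclP y; exists x; apply: inj_i; rewrite qE; exact: xE.
Qed.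

(** Exactness of tensoring reduces to injections, since the image of [g] splits
    an exact pair into a right exact part, preserved by every tensor product,
    and an injection; and injections are measured by Tor_1 of their cokernels. *)
Lemma flat_leftP (M : lmodType R) : flat_left M <-> forall X, tor1_zero X M.
Proof.
rewrite -preserves_leftP; split=> [flatM A B f /exact0_injective ex | presM].
  apply: raddf_inj => t /(flatM _ _ _ _ _ ex)[x <-].
  by apply: tens_map_eq0; left.
move=> A B C f g ex_g.
have [I [q [i [sur_q inj_i qE]]]] := image_factorization g.
have ex_q : exact_at f q.
  move=> y; rewrite -ex_g -qE; split=> [->|]; first exact: linear0.
  by rewrite -[X in _ = X](linear0 i) => /inj_i.
move=> t; rewrite -(tens_right_exactl (M := M) ex_q sur_q t).
rewrite -(tens_map_comp (f := q) (f' := i) (g := id_module M)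
  (g' := id_module M) qE) //.
split=> [|->]; last exact: raddf0.
rewrite -[X in _ = X](raddf0 (tens_map i (id_module M))).
by move=> /(presM _ _ _ inj_i).
Qed.

Lemma flat_rightP (X : lmodType R^c) : flat_right X <-> forall M, tor1_zero X M.
Proof.
rewrite -preserves_rightP; split=> [flatX A B f /exact0_injective ex | presX].
  apply: raddf_inj => t /(flatX _ _ _ _ _ ex)[x <-].
  by apply: tens_map_eq0; right.
move=> A B C f g ex_g.
have [I [q [i [sur_q inj_i qE]]]] := image_factorization g.
have ex_q : exact_at f q.
  move=> y; rewrite -ex_g -qE; split=> [->|]; first exact: linear0.
  by rewrite -[X in _ = X](linear0 i) => /inj_i.
move=> t; rewrite -(tens_right_exactr (B := X) ex_q sur_q t).
have qE1 x : id_module X (id_module X x) = id_module X x by [].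
rewrite -(tens_map_comp (g := q) (g' := i) qE1 qE) //.
split=> [|->]; last exact: raddf0.
rewrite -[X in _ = X](raddf0 (tens_map (id_module X) i)).
by move=> /(presX _ _ _ inj_i).
Qed.

Lemma free_flat_left (K : choiceType) : flat_left (free_module R K).
Proof. exact/flat_leftP/preserves_leftP/free_preserves_left. Qed.

Lemma free_flat_right (K : choiceType) : flat_right (free_module R^c K).
Proof. exact/flat_rightP/preserves_rightP/free_preserves_right. Qed.

(** * Higher Tor and dimension shifting *)

(** The piece Tor_1(N, G) -> Tor_1(N, M) -> N (x) K -> N (x) G of the long exact
    sequence. *)
Lemma tor1_quotient (N : lmodType R^c) (K G M : lmodType R)
    (f : {linear K -> G}) (g : {linear G -> M}) :
  short_exact f g -> injective (tens_map (id_module N) f) -> tor1_zero N G ->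
  tor1_zero N M.
Proof.
move=> ses_g inj_f tzG; have ses_N := Omega_short_exact N.
apply: (tor1_zero_of_left ses_N); first exact: free_preserves_right.
apply: (tens_injective_left ses_N ses_g inj_f).
exact: tor1_zero_injective_left ses_N tzG.
Qed.

Lemma injective_square (A B C D : Type) (u : A -> B) (v : B -> D) (u' : A -> C)
    (v' : C -> D) :
  (forall x, v (u x) = v' (u' x)) -> injective u' -> injective v' -> injective u.
Proof. by move=> sq iu' iv' x y uxy; apply/iu'/iv'; rewrite -!sq uxy. Qed.

(** Since Tor_1 of [Omega X] is Tor_2 of [X], this is the piece
    Tor_2(X, G) -> Tor_2(X, M) -> Tor_1(X, K) of the long exact sequence. *)
Lemma tor1_shift_quotient (X : lmodType R^c) (K G M : lmodType R)
    (f : {linear K -> G}) (g : {linear G -> M}) :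
  short_exact f g -> tor1_zero X K -> tor1_zero (Omega X) G ->
  tor1_zero (Omega X) M.
Proof.
move=> ses_g tzK; have ses_X := Omega_short_exact X.
apply: (tor1_quotient ses_g).
apply: (injective_square (tens_map_square (Omega_incl X) f)).
  exact: tor1_zero_injective_left ses_X tzK.
by apply: free_preserves_right; case: ses_g.
Qed.

(** The piece Tor_2(X, M) -> Tor_1(X, K) -> Tor_1(X, G) of the long exact
    sequence. *)
Lemma tor1_shift_sub (X : lmodType R^c) (K G M : lmodType R)
    (f : {linear K -> G}) (g : {linear G -> M}) :
  short_exact f g -> tor1_zero (Omega X) M -> tor1_zero X G -> tor1_zero X K.
Proof.
move=> ses_g tzM tzG; have ses_X := Omega_short_exact X.
apply: (tor1_zero_of_left ses_X); first exact: free_preserves_right.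
apply: (injective_square (fun t => esym (tens_map_square (Omega_incl X) f t))).
  exact: tzM ses_g.
exact: tor1_zero_injective_left ses_X tzG.
Qed.

Lemma tor1_quotient_right (N L X : lmodType R^c) (i : {linear N -> L})
    (p : {linear L -> X}) (M : lmodType R) :
  short_exact i p -> injective (tens_map i (id_module M)) -> tor1_zero L M ->
  tor1_zero X M.
Proof.
move=> ses_p inj_i tzL; have ses_M := Omega_short_exact M.
apply: (tor1_zero_of_right ses_M); first exact: free_preserves_left.
by apply: (tens_injective_right ses_p ses_M inj_i); exact: tzL ses_M.
Qed.

(** The piece Tor_2(L, M) -> Tor_2(X, M) -> Tor_1(N, M) of the long exact
    sequence in the first variable, with Tor_2(-, M) read as Tor_1(-, Omega M). *)
Lemma tor1_shift_quotient_right (N L X : lmodType R^c) (M : lmodType R)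
    (i : {linear N -> L}) (p : {linear L -> X}) :
  short_exact i p -> tor1_zero N M -> tor1_zero L (Omega M) ->
  tor1_zero X (Omega M).
Proof.
move=> ses_p tzN; have ses_M := Omega_short_exact M.
apply: (tor1_quotient_right ses_p).
apply: (injective_square (fun t => esym (tens_map_square i (Omega_incl M) t))).
  exact: tzN ses_M.
by apply: free_preserves_left; case: ses_p.
Qed.

Lemma tor1_zero_extension (X : lmodType R^c) (K P M : lmodType R)
    (f : {linear K -> P}) (g : {linear P -> M}) :
  short_exact f g -> tor1_zero X K -> tor1_zero X M -> tor1_zero X P.
Proof.
move=> ses_g tzK tzM; have ses_X := Omega_short_exact X.
have [inj_f ex_g sur_g] := ses_g.
apply: (tor1_zero_of_left ses_X); first exact: free_preserves_right.
apply: raddf_inj => t /= t0.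
have /(tens_right_exactr ex_g sur_g)[u uE] : tens_map (id_module _) g t = 0.
  apply: (tor1_zero_injective_left ses_X tzM).
  by rewrite tens_map_square t0 !raddf0.
rewrite -uE; suff -> : u = 0 by exact: raddf0.
apply: (tor1_zero_injective_left ses_X tzK).
apply: (free_preserves_right inj_f).
by rewrite -tens_map_square uE t0 !raddf0.
Qed.

(** Both sides mean Tor_2(X, M) = 0; the presentation of [M] by a free module
    makes the two shifts inverse to each other. *)
Lemma tor1_Omega_balance (X : lmodType R^c) (M : lmodType R) :
  tor1_zero (Omega X) M <-> tor1_zero X (Omega M).
Proof.
have ses_M := Omega_short_exact M.
have tzF Y := (flat_leftP _).1 (@free_flat_left M) Y.
split=> tz; first exact: tor1_shift_sub ses_M tz (tzF _).
exact: tor1_shift_quotient ses_M tz (tzF _).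
Qed.

(** Stands for Tor_(k+1)(X, M) = 0, with the syzygies taken in the first
    variable. *)
Definition tor_zero (k : nat) (X : lmodType R^c) (M : lmodType R) : Prop :=
  tor1_zero (iter k (@Omega R^c) X) M.

Lemma tor_zero_balance k X M :
  tor_zero k X M <-> tor1_zero X (iter k (@Omega R) M).
Proof.
rewrite /tor_zero; elim: k M => // k IH M.
by rewrite iterS tor1_Omega_balance IH iterSr.
Qed.

Lemma tor_zero_quotient k (X : lmodType R^c) (K G M : lmodType R)
    (f : {linear K -> G}) (g : {linear G -> M}) :
  short_exact f g -> tor_zero k X K -> tor_zero k.+1 X G -> tor_zero k.+1 X M.
Proof. exact: tor1_shift_quotient. Qed.

Lemma tor_zero_sub k (X : lmodType R^c) (K G M : lmodType R)
    (f : {linear K -> G}) (g : {linear G -> M}) :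
  short_exact f g -> tor_zero k.+1 X M -> tor_zero k X G -> tor_zero k X K.
Proof. exact: tor1_shift_sub. Qed.

Lemma flat_tor_zero k X (M : lmodType R) : flat_left M -> tor_zero k X M.
Proof. by move=> /flat_leftP; exact. Qed.

(** Tor is a functor of its second variable, so its vanishing passes to direct
    summands. *)
Lemma tor_zero_retract k X (E H : lmodType R) (i : {linear E -> H})
    (r : {linear H -> E}) :
  cancel i r -> tor_zero k X H -> tor_zero k X E.
Proof.
rewrite /tor_zero; move: (iter _ _ _) => N ir tzH.
have ses_N := Omega_short_exact N.
apply: (tor1_zero_of_left ses_N); first exact: free_preserves_right.
apply: (injective_square (fun t => esym (tens_map_square (Omega_incl N) i t))).
  apply: (can_inj (g := tens_map (id_module _) r)) => t.
  rewrite (tens_map_comp (f'' := id_module _) (g'' := id_module _)) //.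
  exact: tens_map_id.
exact: tor1_zero_injective_left ses_N tzH.
Qed.

(** Here [g] is an isomorphism; this is the form in which a resolution of length
    0 presents its module. *)
Lemma tor_zero_trivial_sub k X (K G M : lmodType R) (f : {linear K -> G})
    (g : {linear G -> M}) :
  short_exact f g -> (forall x : K, x = 0) -> tor_zero k X G -> tor_zero k X M.
Proof.
move=> ses_g K0; apply: (tor1_quotient ses_g); apply: raddf_inj => t _.
elim/tens_ind: t => [t u -> ->|x m]; first by rewrite subrr.
by rewrite (K0 m) tensor0r.
Qed.

End Tor1.

(** * Resolutions and finiteness of dimensions *)

Section Resolutions.
Context (R : pzRingType) (P : lmodType R -> Prop).

Lemma has_resolution0 M : has_resolution P M 0 ->
  exists (K G : lmodType R) (f : {linear K -> G}) (g : {linear G -> M}),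
    [/\ short_exact f g, P G & forall x : K, x = 0].
Proof.
move=> [G [d [eps [PG G0 sur_eps ex0 ex]]]].
exists (G 1%N), (G 0%N), (d 0%N), eps; split; [split=> //| exact: PG | exact: G0].
by move=> x y _; rewrite (G0 _ _ x) // (G0 _ _ y).
Qed.

Lemma has_resolutionS M k : has_resolution P M k.+1 ->
  exists (K G : lmodType R) (f : {linear K -> G}) (g : {linear G -> M}),
    [/\ short_exact f g, P G & has_resolution P K k].
Proof.
move=> [G [d [eps [PG G0 sur_eps ex0 ex]]]].
pose f := incl (ker_submodule eps).
have inj_f : injective f by exact: incl_inj.
have ex_f : exact_at f eps by exact: ker_exact.
have [e eE] : exists e : {linear G 1%N -> submodule_type (ker_submodule eps)},
    forall x, f (e x) = d 0%N x.
  by apply: lift_injective => // x; apply/ex_f/ex0; exists x.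
exists (submodule_type (ker_submodule eps)), (G 0%N), f, eps.
split; [by split | exact: PG |].
exists (fun n => G n.+1), (fun n => d n.+1), e; split=> [n|n|y|y|n].
- by move=> nk; exact: PG.
- by move=> kn; exact: G0.
- have /ex0[x xE] : eps (f y) = 0 by apply/ex_f; exists y.
  by exists x; apply: inj_f; rewrite eE xE.
- rewrite -(ex 0%N) -eE; split=> [->|]; first exact: linear0.
  by rewrite -[X in _ = X](linear0 f) => /inj_f.
- exact: ex.
Qed.

Lemma has_resolution_cons (K G M : lmodType R) (f : {linear K -> G})
    (g : {linear G -> M}) k :
  short_exact f g -> P G -> has_resolution P K k -> has_resolution P M k.+1.
Proof.
move=> [inj_f ex_f sur_g] PG [H [d [eps [PH H0 sur_eps ex0 ex]]]].
pose G' n : lmodType R := if n is n'.+1 then H n' else G.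
pose d' n : {linear G' n.+1 -> G' n} :=
  match n with 0 => f \o eps | n'.+1 => d n' end.
exists G', d', g; split=> [[|n]|[|n]|//|y|[|n]] //=.
- exact: PH.
- exact: H0.
- rewrite ex_f; split=> [[x <-]|[z <-]]; last by exists (eps z).
  by have [z <-] := sur_eps x; exists z.
- move=> y; rewrite -ex0 /=; split=> [|->]; last exact: linear0.
  by rewrite -[X in _ = X](linear0 f) => /inj_f.
Qed.

Lemma has_resolution_self M : P M -> has_resolution P M 0.
Proof.
move=> PM; pose Z := free_module R void.
have Z0 (x : Z) : x = 0 by apply: free_ext => -[].
pose G n : lmodType R := if n is _.+1 then Z else M.
exists G, (fun n => \0), (@idfun M : {linear G 0%N -> M}).
split=> [[|n]|[|n]|y|y|n y] //=.
- by exists y.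
- by split=> [->|[x <-]] //; exists 0.
Qed.

End Resolutions.

Section Dimensions.
Context (R : pzRingType) (P : lmodType R -> Prop).

Local Notation dim_of n := ((n%:Z)%:E : \bar int).

(** Lengths are natural numbers, so the infimum is a minimum whenever some
    resolution exists. *)
Lemma resolution_dim_cases M :
  (exists k, [/\ has_resolution P M k, resolution_dim P M = dim_of k
               & forall j, has_resolution P M j -> (k <= j)%N]) \/
  ((forall k, ~ has_resolution P M k) /\ resolution_dim P M = +oo%E).
Proof.
rewrite /resolution_dim /infimum; case: ifPn => [/eqP S0|/set0P[_ [k0 res0 _]]].
  right; split=> // k res; suff : (set0 : set (\bar int)) (dim_of k) by [].
  by rewrite -S0; exists k.
left; have ex : exists k, `[< has_resolution P M k >] by exists k0; exact/asboolP.
have [k /asboolP res min_k] := ex_minnP ex.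
exists k; split=> [//||j resj]; last by apply: min_k; exact/asboolP.
apply: xget_subset1; last exact: is_subset1_infimums.
split=> [_ [j resj <-]|y]; last by apply; exists k.
by rewrite lee_fin lez_nat; apply: min_k; exact/asboolP.
Qed.

Lemma resolution_dim_ge0 M : (0 <= resolution_dim P M)%E.
Proof.
by have [[k [_ -> _]]|[_ ->]] := resolution_dim_cases M; rewrite ?lee_fin.
Qed.

Lemma resolution_dim_le M n :
  (resolution_dim P M <= dim_of n)%E <->
  exists2 k, (k <= n)%N & has_resolution P M k.
Proof.
have [[k [res -> min_k]]|[nres ->]] := resolution_dim_cases M.
  rewrite lee_fin lez_nat; split=> [kn|[j jn /min_k kj]]; first by exists k.
  exact: leq_trans kj jn.
by split=> // -[k _ /nres].
Qed.

(** In the integers extended by infinities, a set of dimensions has a supremum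
    in all cases: a largest element if it is bounded, [+oo] otherwise. *)
Lemma class_resolution_dim_finP (X : lmodType R -> Prop) :
  class_resolution_dim P X \is a fin_num <->
  exists n, forall M, X M -> exists2 k, (k <= n)%N & has_resolution P M k.
Proof.
rewrite /class_resolution_dim; set D := (D in supremum _ D).
have ubP n : ubound D (dim_of n) <->
    forall M, X M -> exists2 k, (k <= n)%N & has_resolution P M k.
  split=> [ub M XM|bd _ [M XM ->]]; last exact/resolution_dim_le/bd.
  by apply/resolution_dim_le/ub; exists M.
rewrite /supremum; case: ifPn => [/eqP D0|/set0P[d0 Dd0]].
  split=> // _; exists 0%N; apply/ubP => d; rewrite D0.
  by [].
have ub_cases y : ubound D y -> y = +oo%E \/ exists n, y = dim_of n.
  move=> /(_ _ Dd0) d0y; have {d0y}: (0 <= y)%E.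
    apply: le_trans d0y; have [M _ ->] := Dd0; exact: resolution_dim_ge0.
  by case: y => [[n|n]|//|//] //; [right; exists n | left].
split=> [fin|[n bd]].
  apply: contrapT => nbd; move: fin; rewrite (xget_subset1 _ (x := +oo%E)) //.
    split=> [d _|y uby]; first exact: leey.
    have [->//|[n yn]] := ub_cases y uby.
    by case: nbd; exists n; apply/ubP; rewrite -yn.
  exact: is_subset1_supremums.
have ex : exists n, `[< ubound D (dim_of n) >].
  by exists n; apply/asboolP/ubP.
have [k /asboolP ubk min_k] := ex_minnP ex.
rewrite (xget_subset1 _ (x := dim_of k)) //; last exact: is_subset1_supremums.
split=> // y uby; have [->|[j yj]] := ub_cases y uby; first exact: leey.
by rewrite yj lee_fin lez_nat; apply: min_k; apply/asboolP; rewrite -yj.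
Qed.

End Dimensions.

(** * Enough injective modules *)

Definition divisible (D : zmodType) : Prop :=
  forall (n : nat) (x : D), exists y, y *+ n.+1 = x.

Section DivisibleHull.
Context (M : zmodType).

Let eval (v : {freeg M}) : zmodule M := fglift (fun m : M => m : zmodule M) v.

Let evalB u v : eval (u - v) = eval u - eval v.
Proof. exact: (@lift_is_additive _ _ (zmodule M) _ u v). Qed.

Let evalU m : eval << m >> = m.
Proof. by rewrite /eval liftU scale1r. Qed.

(** Write [M] as the free abelian group on its elements modulo the relations
    that hold in [M], and replace the free group by the divisible group of all
    rational-valued functions on [M], keeping the relations. A relation of the
    form of a single generator [m] evaluates to [m], whence the injectivity. *)
Lemma divisible_hull_exists : exists (D : zmodType) (i : {additive M -> D}),
  divisible D /\ injective i.
Proof.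
pose S (F : M -> rat) := exists v : {freeg M},
  eval v = 0 /\ forall m, F m = (coeff m v)%:~R.
have [||Q [q [sur_q qS]]] := @zmod_quotient_exists _ S.
- exists 0; split=> [|m]; last by rewrite coeff0.
  by have := evalB 0 0; rewrite !subrr.
- move=> F F' [v [v0 Fv]] [v' [v'0 Fv']]; exists (v - v'); split=> [|m].
    by rewrite evalB v0 v'0 subrr.
  by rewrite coeffB rmorphB /= -Fv -Fv'.
pose delta (m : M) : M -> rat := fun x => (m == x)%:R.
have add_i : zmod_morphism (fun m => q (delta m)).
  move=> m m'; apply/eqP; rewrite -subr_eq0 -!raddfB; apply/eqP/qS.
  exists (<< m - m' >> - (<< m >> - << m' >>)).
  split=> [|x]; first by rewrite !evalB !evalU subrr.
  rewrite !coeffB !coeffU !mul1r !rmorphB /= !rmorph_nat.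
  by [].
pose i : {additive M -> Q} :=
  HB.pack (fun m => q (delta m)) (GRing.isZmodMorphism.Build M Q _ add_i).
exists Q, i; split=> [n x|].
  have [F <-] := sur_q x; exists (q (fun m => F m / n.+1%:R)).
  rewrite -raddfMn; congr (q _); apply/funext => m.
  by rewrite natmulfctE /= -[LHS]mulr_natr mulfVK // pnatr_eq0.
apply: raddf_inj => m /qS[v [v0 vm]].
(* The coefficients of [v] are those of the single generator [m]. *)
have e : v = << m >>.
  apply/eqP/freeg_eqP => x; rewrite coeffU mul1r.
  by apply: (@intr_inj rat); rewrite -vm rmorph_nat.
by move: v0; rewrite e evalU.
Qed.

End DivisibleHull.

Section ExtendToDivisible.
Context (A B D : zmodType) (f : {additive A -> B}) (g : {additive A -> D}).
Hypotheses (inj_f : injective f) (div_D : divisible D).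

Let partial_extension (G : set (B * D)) : Prop :=
  [/\ forall x y, G x -> G y -> G (x - y), forall d, G (0, d) -> d = 0
    & forall a, G (f a, g a)].

Let graph : set (B * D) := [set x : B * D | exists a, (f a, g a) = x]%classic.

Let graph_extension : partial_extension graph.
Proof.
split=> [_ _ [a <-] [a' <-]|d [a [fa0 <-]]|a]; last by exists a.
  by exists (a - a'); rewrite !raddfB.
have -> : a = 0 by apply: inj_f; rewrite fa0 raddf0.
exact: raddf0.
Qed.

Let extensionMz G : partial_extension G ->
  forall (n : int) b d, G (b, d) -> G (b *~ n, d *~ n).
Proof.
move=> [GB _ _] n b d Gbd.
have G0 : G (0, 0) by have := GB _ _ Gbd Gbd; rewrite subrr.
have GN x y : G (x, y) -> G (- x, - y).
  by move=> /(GB _ _ G0); rewrite pair_sub !sub0r.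
have Gn k : G (b *+ k, d *+ k).
  elim: k => [|k IH]; first by rewrite !mulr0n.
  have Gm := GN _ _ Gbd; have := GB _ _ IH Gm.
  by rewrite pair_sub !opprK -!mulrSr.
case: n => n; first by rewrite -!pmulrn.
by rewrite NegzE !mulrNz -!pmulrn; exact: GN.
Qed.

(** The multiples of [b] at which [G] prescribes a value form a subgroup of the
    integers: either 0 alone, where the value is 0, or the multiples of some
    [n0.+1], and dividing the value there by [n0.+1] settles all of them. *)
Let extension_value G b : partial_extension G ->
  exists d0, forall (n : int) d, G (b *~ n, d) -> d = d0 *~ n.
Proof.
move=> GE; have [GB G0 _] := GE.
have G00 : G (0, 0) by have [_ _ /(_ 0)] := GE; rewrite !raddf0.
have [pos|npos] :=
    pselect (exists n, `[< exists d, G (b *+ n.+1, d) >]); last first.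
  exists 0 => n d Gnd; rewrite mul0rz.
  have GN : G (b *~ (- n), - d).
    by rewrite mulrNz; have := GB _ _ G00 Gnd; rewrite pair_sub !sub0r.
  case: n => [[|n]|n] in Gnd GN *; first exact: G0.
    by case: npos; exists n; apply/asboolP; exists d; rewrite pmulrn.
  case: npos; exists n; apply/asboolP; exists (- d).
  by move: GN; rewrite NegzE opprK -pmulrn.
have [n0 /asboolP[e Ge] min_n0] := ex_minnP pos.
have [d0 d0E] := div_D n0 e; exists d0 => n d Gnd.
(* By minimality of [n0.+1], the remainder of [n] is 0. *)
pose r := (n %% n0.+1%:Z)%Z; pose k := (n %/ n0.+1%:Z)%Z.
have nE : n = k * n0.+1%:Z + r by exact: divz_eq.
have Gr : G (b *~ r, d - e *~ k).
  have := GB _ _ Gnd (extensionMz GE k Ge); rewrite pair_sub.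
  by rewrite pmulrn -mulrzA mulrC -mulrzBr {1}nE addrAC subrr add0r.
have r0 : r = 0.
  have : 0 <= r < n0.+1%:Z by rewrite modz_ge0 // ltz_pmod.
  case: (r) Gr => [[|j]|j] // Gr /andP[_ jn].
  have n0j : (n0 <= j)%N.
    by apply: min_n0; apply/asboolP; exists (d - e *~ k); rewrite pmulrn.
  by move: jn; rewrite ltz_nat ltnS ltnNge n0j.
move: Gr; rewrite r0 mulr0z => /G0 /eqP; rewrite subr_eq0 => /eqP ->.
by rewrite nE r0 addr0 -d0E pmulrn -mulrzA mulrC.
Qed.

(** Zorn's lemma for graphs of partial extensions: a maximal one is defined
    everywhere, because [extension_value] allows one more element [b] in the
    domain. *)
Lemma extend_to_divisible : exists h : {additive B -> D}, forall a, h (f a) = g a.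
Proof.
have [F chF tot|G [GP maxG]] :=
    @Zorn_bigcup _ [set G | G = set0 \/ partial_extension G].
  have [[G FG GE]|nex] :=
      pselect (exists2 G, F G & partial_extension G); last first.
    left; apply/seteqP; split=> // x [G FG Gx].
    case: (chF G FG) => [G0|GE]; first by rewrite G0 in Gx.
    by case: nex; exists G.
  have good H x : F H -> H x -> partial_extension H.
    by move=> FH Hx; case: (chF H FH) => // H0; rewrite H0 in Hx.
  right; split=> [x y [H FH Hx] [H' FH' H'y]|d [H FH Hd]|a].
  - have [HH'|H'H] := tot H H' FH FH'.
      exists H' => //; have [HB _ _] := good _ _ FH' H'y.
      by apply: HB => //; exact: HH'.
    exists H => //; have [HB _ _] := good _ _ FH Hx.
    by apply: HB => //; exact: H'H.
  - by have [_ H0 _] := good _ _ FH Hd; exact: H0.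
  - by exists G => //; have [_ _] := GE; exact.
have GE : partial_extension G.
  case: GP => // G0; case: (maxG graph); last by right; exact: graph_extension.
  by rewrite G0; split=> // /(_ (f 0, g 0)); apply; exists 0.
have [GB G0 Ggr] := GE.
have G00 : G (0, 0) by have := Ggr 0; rewrite !raddf0.
have total b : exists d, G (b, d).
  apply: contrapT => nb; have [d0 d0P] := extension_value b GE.
  pose G' : set (B * D) :=
    [set z | exists x y (n : int),
      G (x, y) /\ z = (x + b *~ n, y + d0 *~ n)]%classic.
  apply: (maxG G').
    split=> [[x y] Gxy|GG']; first by exists x, y, 0; rewrite !mulr0z !addr0.
    apply: nb; exists d0; apply: GG'; exists 0, 0, 1.
    by rewrite !mulr1z !add0r.
  right.
  split=> [_ _ [x [y [n [Gxy ->]]]] [x' [y' [n' [Gxy' ->]]]]|d|a].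
  - exists (x - x'), (y - y'), (n - n'); split; first exact: (GB _ _ Gxy Gxy').
    by rewrite pair_sub !mulrzBr !opprD; congr pair; exact: addrACA.
  - move=> [x [y [n [Gxy [/esym/eqP + ->]]]]]; rewrite addrC addr_eq0 => /eqP bn.
    have := GB _ _ G00 Gxy; rewrite pair_sub !sub0r -bn => /d0P <-.
    by rewrite addrN.
  - by exists (f a), (g a), 0; rewrite !mulr0z !addr0.
have [h hG] := choice total.
have hE b d : G (b, d) -> h b = d.
  move=> Gbd; apply/eqP; rewrite -subr_eq0; apply/eqP/G0.
  by have := GB _ _ (hG b) Gbd; rewrite pair_sub subrr.
have add_h : zmod_morphism h.
  by move=> x y; apply: hE; exact: (GB _ _ (hG x) (hG y)).
pose h' : {additive B -> D} := HB.pack h (GRing.isZmodMorphism.Build B D _ add_h).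
by exists h' => a; exact: hE.
Qed.

End ExtendToDivisible.

Section Coinduced.
Context (R : pzRingType) (D : zmodType).

Definition additive_pred : (R -> D) -> bool :=
  fun phi => `[< zmod_morphism phi >].

Lemma additive_pred_closed : zmod_closed additive_pred.
Proof.
split=> [|phi psi /asboolP hphi /asboolP hpsi]; apply/asboolP => x y.
  by rewrite [RHS]subrr.
rewrite [LHS]/(phi _ - psi _) hphi hpsi.
rewrite [RHS]/(phi x - psi x - (phi y - psi y)) !opprD; exact: addrACA.
Qed.

HB.instance Definition _ :=
  GRing.isZmodClosed.Build (R -> D) additive_pred additive_pred_closed.

(** The additive maps from the ring to [D], on which [a] acts by translation of
    the argument: the right adjoint of the forgetful functor to abelian groups. *)
Definition coinduced : Type := {phi : R -> D | additive_pred phi}.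

HB.instance Definition _ := [isSub of coinduced for @sval (R -> D) additive_pred].
HB.instance Definition _ := [Choice of coinduced by <:].
HB.instance Definition _ := [SubChoice_isSubZmodule of coinduced by <:].

Lemma coinducedB (phi : coinduced) x y : val phi (x - y) = val phi x - val phi y.
Proof. by have /asboolP := valP phi; exact. Qed.

Lemma coinduced_ext (phi psi : coinduced) : val phi =1 val psi -> phi = psi.
Proof. by move=> e; apply: val_inj; exact/funext. Qed.

Lemma coinduced_exists (phi : R -> D) : zmod_morphism phi ->
  exists psi : coinduced, val psi = phi.
Proof. by move=> /asboolP add; exists (Sub phi add); rewrite SubK. Qed.

Lemma coinduced_scale_subproof (a : R) (phi : coinduced) :
  additive_pred (fun s => val phi (s * a)).
Proof. by apply/asboolP => x y; rewrite mulrBl coinducedB. Qed.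

Definition coinduced_scale (a : R) (phi : coinduced) : coinduced :=
  Sub (fun s => val phi (s * a)) (coinduced_scale_subproof a phi).

Lemma coinduced_scaleE a phi s : val (coinduced_scale a phi) s = val phi (s * a).
Proof. by rewrite SubK. Qed.

Lemma coinducedD (phi : coinduced) x y : val phi (x + y) = val phi x + val phi y.
Proof.
by have := coinducedB phi (x + y) y; rewrite addrK => ->; rewrite subrK.
Qed.

Lemma coinduced_addE (phi psi : coinduced) s :
  val (phi + psi) s = val phi s + val psi s.
Proof. by rewrite raddfD. Qed.

Fact coinduced_scaleA a b phi :
  coinduced_scale a (coinduced_scale b phi) = coinduced_scale (a * b) phi.
Proof. by apply: coinduced_ext => s; rewrite !coinduced_scaleE mulrA. Qed.

Fact coinduced_scale1 : left_id 1 coinduced_scale.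
Proof.
by move=> phi; apply: coinduced_ext => s; rewrite coinduced_scaleE mulr1.
Qed.

Fact coinduced_scaleDr : right_distributive coinduced_scale +%R.
Proof.
move=> a phi psi; apply: coinduced_ext => s.
by rewrite coinduced_scaleE !coinduced_addE !coinduced_scaleE.
Qed.

Fact coinduced_scaleDl phi : {morph coinduced_scale^~ phi : a b / a + b}.
Proof.
move=> a b; apply: coinduced_ext => s; rewrite coinduced_scaleE mulrDr coinducedD.
by rewrite coinduced_addE !coinduced_scaleE.
Qed.

HB.instance Definition _ := GRing.Zmodule_isLmodule.Build R coinduced
  coinduced_scaleA coinduced_scale1 coinduced_scaleDr coinduced_scaleDl.

Lemma coinducedZ a (phi : coinduced) s : val (a *: phi) s = val phi (s * a).
Proof. exact: coinduced_scaleE. Qed.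

Lemma coinduced_oppE (phi psi : coinduced) s :
  val (phi - psi) s = val phi s - val psi s.
Proof. by rewrite raddfB. Qed.

(** The adjunction: an additive map [h] on [X] is the value at 1 of a linear map
    into the coinduced module. *)
Lemma coinduced_linear (X : lmodType R) (h : {additive X -> D}) :
  exists H : {linear X -> (coinduced : lmodType R)},
    forall x s, val (H x) s = h (s *: x).
Proof.
have add x : zmod_morphism (fun s : R => h (s *: x)).
  by move=> s t; rewrite scalerBl raddfB.
have /choice[H HE] x := coinduced_exists (add x).
have lin : linear H.
  move=> a x y; apply: coinduced_ext => s.
  by rewrite coinduced_addE coinducedZ !HE scalerDr raddfD scalerA.
by exists (linear_of lin) => x s; rewrite linear_ofE HE.
Qed.

(** By the adjunction, extending a linear map into the coinduced module is
    extending an additive map into [D]. *)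
Lemma coinduced_injective : divisible D -> injective_module coinduced.
Proof.
move=> divD A B f g inj_f.
have add : zmod_morphism (fun a => val (g a) 1).
  by move=> a a'; rewrite linearB coinduced_oppE.
pose g1 : {additive A -> D} :=
  HB.pack (fun a => val (g a) 1) (GRing.isZmodMorphism.Build A D _ add).
have [h hE] := extend_to_divisible g1 inj_f divD.
have [H HE] := coinduced_linear h; exists H => a; apply: coinduced_ext => s.
by rewrite HE -linearZ hE /= linearZ coinducedZ mul1r.
Qed.

End Coinduced.

(** Embed the underlying group of [M] into a divisible group and transpose this
    embedding by the adjunction. *)
Lemma enough_injectives (R : pzRingType) (M : lmodType R) :
  exists (E : lmodType R) (i : {linear M -> E}),
    injective_module E /\ injective i.
Proof.
have [D [i [divD inj_i]]] := divisible_hull_exists M.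
have [I IE] := coinduced_linear i.
exists (coinduced R D), I; split; first exact: coinduced_injective.
by move=> x y /(congr1 (fun phi => val phi 1)); rewrite !IE !scale1r => /inj_i.
Qed.

(** * Gorenstein flat modules *)

Section GorensteinFlatTheory.
Context (R : pzRingType) (B : lmodType R^c -> Prop).

Lemma flat_preserves_left (M : lmodType R) :
  flat_left M -> preserves_injections_left M.
Proof. by move=> /flat_leftP /preserves_leftP. Qed.

(** Moving the complex one step to the left exhibits the kernel of [F -> G] as
    Gorenstein flat again. The vanishing of Tor_1(X, G) is the exactness of the
    complex tensored with [X] next to that kernel. *)
Lemma Gorenstein_flat_left (G : lmodType R) : Gorenstein_flat B G ->
  exists (K F : lmodType R) (f : {linear K -> F}) (g : {linear F -> G}),
    [/\ short_exact f g, flat_left F & Gorenstein_flat B K] /\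
    forall X, B X -> tor1_zero X G.
Proof.
move=> [lo [up [dlo [dmid [dup [flat ex exB [iota [inj_i ex_i]]]]]]]].
have [ex_lo ex_lo0 ex_up0 ex_up] := ex.
have [g gE] : exists g : {linear lo 0%N -> G}, forall x, iota (g x) = dmid x.
  by apply: lift_injective => // x; apply/ex_i/ex_up0; exists x.
have sur_g : onto g.
  move=> y; have /ex_up0[x xE] : dup 0%N (iota y) = 0 by apply/ex_i; exists y.
  by exists x; apply: inj_i; rewrite gE.
have g0 x : g x = 0 <-> dmid x = 0.
  rewrite -gE; split=> [->|]; first exact: linear0.
  by rewrite -[X in _ = X](linear0 iota) => /inj_i.
have ses_g := ker_short_exact sur_g; set f := incl _ in ses_g.
have [inj_f ex_f _] := ses_g; have flat_lo n : flat_left (lo n) by case: (flat n).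
exists _, (lo 0%N), f, g; split; first split=> //.
  pose up' n : lmodType R := if n is n'.+1 then up n' else lo 0%N.
  pose dup' n : {linear up' n -> up' n.+1} :=
    match n with 0 => dmid | n'.+1 => dup n' end.
  exists (fun n => lo n.+1), up', (fun n => dlo n.+1), (dlo 0%N), dup'; split.
  - case=> [|n]; first by have [] := flat 0%N.
    by have [] := flat n; have [] := flat n.+2.
  - by split=> // -[|n]; [exact: ex_up0 | exact: ex_up].
  - move=> X BX; have [exX_lo exX_lo0 exX_up0 exX_up] := exB X BX.
    by split=> // -[|n]; [exact: exX_up0 | exact: exX_up].
  - by exists f; split=> // x; rewrite -[dup' 0%N x = 0]g0; exact: ex_f.
move=> X BX; have [exX_lo exX_lo0 _ _] := exB X BX.
apply: (tor1_zero_of_right ses_g); first exact: flat_preserves_left.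
have [e eE] : exists e : {linear lo 1%N -> submodule_type (ker_submodule g)},
    forall x, f (e x) = dlo 0%N x.
  by apply: lift_injective => // x; apply/ex_f/g0/ex_lo0; exists x.
have sur_e : onto e.
  move=> y; have /g0/ex_lo0[x xE] : g (f y) = 0 by apply/ex_f; exists y.
  by exists x; apply: inj_f; rewrite eE.
have idE x : id_module X (id_module X x) = id_module X x by [].
apply: raddf_inj => t.
have [u <-] : exists u, tens_map (id_module X) e u = t.
  by apply: tens_map_onto => // x; exists x.
rewrite /= (tens_map_comp idE eE) => /exX_lo[v <-].
rewrite (tens_map_comp (g'' := \0) idE); first by apply: tens_map_eq0; right.
move=> x; apply: inj_f; rewrite eE linear0; exact: exact_comp0 (ex_lo 0%N).
Qed.

Lemma Gorenstein_flat_right (G : lmodType R) : Gorenstein_flat B G ->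
  exists (F C : lmodType R) (f : {linear G -> F}) (g : {linear F -> C}),
    [/\ short_exact f g, flat_left F & Gorenstein_flat B C].
Proof.
move=> [lo [up [dlo [dmid [dup [flat ex exB [iota [inj_i ex_i]]]]]]]].
have [ex_lo ex_lo0 ex_up0 ex_up] := ex.
pose f := incl (ker_submodule (dup 1%N)).
have inj_f : injective f by exact: incl_inj.
have ex_f : exact_at f (dup 1%N) by exact: ker_exact.
have [g gE] :
    exists g : {linear up 0%N -> submodule_type (ker_submodule (dup 1%N))},
      forall x, f (g x) = dup 0%N x.
  by apply: lift_injective => // x; apply/ex_f/ex_up; exists x.
exists (up 0%N), _, iota, g; split; first split=> //.
- move=> x; rewrite -ex_i -gE; split=> [->|]; first exact: linear0.
  by rewrite -[X in _ = X](linear0 f) => /inj_f.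
- move=> y; have /ex_up[x xE] : dup 1%N (f y) = 0 by apply/ex_f; exists y.
  by exists x; apply: inj_f; rewrite gE.
- by have [] := flat 0%N.
pose lo' n : lmodType R := if n is n'.+1 then lo n' else up 0%N.
pose dlo' n : {linear lo' n.+1 -> lo' n} :=
  match n with 0 => dmid | n'.+1 => dlo n' end.
exists lo', (fun n => up n.+1), dlo', (dup 0%N), (fun n => dup n.+1); split.
- case=> [|n]; first by have [] := flat 0%N; have [] := flat 1%N.
  by have [] := flat n; have [] := flat n.+2.
- split=> [[|n]|||n].
  + exact: ex_lo0.
  + exact: ex_lo.
  + exact: ex_up0.
  + exact: ex_up.
  + exact: ex_up.
- move=> X BX; have [exX_lo exX_lo0 exX_up0 exX_up] := exB X BX.
  split=> [[|n]|||n].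
  + exact: exX_lo0.
  + exact: exX_lo.
  + exact: exX_up0.
  + exact: exX_up.
  + exact: exX_up.
- by exists f.
Qed.

(** Two short exact sequences sharing a term compose to an exact complex. *)
Lemma splice_exact (F0 A F C F' : zmodType) (u : F0 -> F) (v : F -> F')
    (e : F0 -> A) (i : A -> F) (p : F -> C) (j : {additive C -> F'}) :
  onto e -> exact_at i p -> injective j ->
  (forall x, i (e x) = u x) -> (forall x, j (p x) = v x) -> exact_at u v.
Proof.
move=> sur_e ex_p inj_j uE vE y; rewrite -vE; split=> [jp0|[x <-]].
  have /ex_p[a aE] : p y = 0 by apply: inj_j; rewrite raddf0.
  by have [x xE] := sur_e a; exists x; rewrite -uE xE.
have -> : p (u x) = 0 by apply/ex_p; exists (e x).
exact: raddf0.
Qed.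

Section Splice.
Context (F0 A F C F' D : lmodType R) (e : {linear F0 -> A}) (i : {linear A -> F})
  (p : {linear F -> C}) (j : {linear C -> F'}) (q : {linear F' -> D}).
Hypotheses (sur_e : onto e) (ses_p : short_exact i p) (ses_q : short_exact j q).

Lemma splice_modules : exact_at (i \o e) (j \o p).
Proof.
have [_ ex_p _] := ses_p; have [inj_j _ _] := ses_q.
exact: (splice_exact sur_e ex_p inj_j).
Qed.

(** Tor_1(X, D) = 0 is what keeps [j] injective after tensoring with [X]. *)
Lemma splice_tensor X : tor1_zero X D ->
  exact_at (tens_map (id_module X) (i \o e)) (tens_map (id_module X) (j \o p)).
Proof.
have [_ ex_p sur_p] := ses_p => tzD.
have ex := tens_right_exactr (B := X) ex_p sur_p.
have sur : onto (tens_map (id_module X) e).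
  by apply: tens_map_onto => // x; exists x.
by apply: (splice_exact sur ex (tzD _ _ _ _ ses_q)) => t; exact: tens_map_comp.
Qed.

End Splice.

Section Coinduction.
Context (C : lmodType R -> Prop).
Hypothesis C_tor1 : forall G, C G -> forall X, B X -> tor1_zero X G.
Hypothesis C_left : forall G, C G ->
  exists (K F : lmodType R) (f : {linear K -> F}) (g : {linear F -> G}),
    [/\ short_exact f g, flat_left F & C K].
Hypothesis C_right : forall G, C G ->
  exists (F K : lmodType R) (f : {linear G -> F}) (g : {linear F -> K}),
    [/\ short_exact f g, flat_left F & C K].

Record member := Member {
  member_module :> lmodType R; member_in : C member_module }.

Record left_step (G : lmodType R) := LeftStep {
  left_ker : member; left_mid : lmodType R;
  left_incl : {linear left_ker -> left_mid}; left_proj : {linear left_mid -> G};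
  left_ses : short_exact left_incl left_proj; left_flat : flat_left left_mid }.

Record right_step (G : lmodType R) := RightStep {
  right_mid : lmodType R; right_coker : member;
  right_incl : {linear G -> right_mid};
  right_proj : {linear right_mid -> right_coker};
  right_ses : short_exact right_incl right_proj;
  right_flat : flat_left right_mid }.

Lemma left_step_exists (G : member) : exists s : left_step G, True.
Proof.
have [K [F [f [g [ses flat CK]]]]] := C_left (member_in G).
by exists (@LeftStep G (Member CK) F f g ses flat).
Qed.

Lemma right_step_exists (G : member) : exists s : right_step G, True.
Proof.
have [F [K [f [g [ses flat CK]]]]] := C_right (member_in G).
by exists (@RightStep G F (Member CK) f g ses flat).
Qed.

(** Gorenstein flat modules form the largest class whose members have vanishing
    Tor_1 against the test modules and are both quotients and submodules of
    flat modules, with kernel and cokernel in the class again: splicing the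
    successive steps on either side yields the complex. *)
Lemma Gorenstein_flat_coinduction G : C G -> Gorenstein_flat B G.
Proof.
move=> CG.
pose L (H : member) := sval (cid (left_step_exists H)).
pose U (H : member) := sval (cid (right_step_exists H)).
pose l := fix l n : member :=
  if n is n'.+1 then left_ker (L (l n')) else Member CG.
pose u := fix u n : member :=
  if n is n'.+1 then right_coker (U (u n')) else Member CG.
pose dlo n : {linear left_mid (L (l n.+1)) -> left_mid (L (l n))} :=
  left_incl (L (l n)) \o left_proj (L (l n.+1)).
pose dmid : {linear left_mid (L (l 0%N)) -> right_mid (U (u 0%N))} :=
  right_incl (U (u 0%N)) \o left_proj (L (l 0%N)).
pose dup n : {linear right_mid (U (u n)) -> right_mid (U (u n.+1))} :=
  right_incl (U (u n.+1)) \o right_proj (U (u n)).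
have sur_l n : onto (left_proj (L (l n))) by case: (left_ses (L (l n))).
have sur_u n : onto (right_proj (U (u n))) by case: (right_ses (U (u n))).
exists (fun n => left_mid (L (l n))), (fun n => right_mid (U (u n))).
exists dlo, dmid, dup; split.
- by move=> n; split; [exact: left_flat | exact: right_flat].
- split=> [n|||n].
  + exact: (splice_modules (sur_l n.+2) (left_ses (L (l n.+1)))
      (left_ses (L (l n)))).
  + exact: (splice_modules (sur_l 1%N) (left_ses (L (l 0%N)))
      (right_ses (U (u 0%N)))).
  + exact: (splice_modules (sur_l 0%N) (right_ses (U (u 0%N)))
      (right_ses (U (u 1%N)))).
  + exact: (splice_modules (sur_u n) (right_ses (U (u n.+1)))
      (right_ses (U (u n.+2)))).
- move=> X BX.
  have tz (H : member) : tor1_zero X H by exact: C_tor1 (member_in H) _ BX.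
  split=> [n|||n].
  + exact: (splice_tensor (sur_l n.+2) (left_ses (L (l n.+1)))
      (left_ses (L (l n))) (tz _)).
  + exact: (splice_tensor (sur_l 1%N) (left_ses (L (l 0%N)))
      (right_ses (U (u 0%N))) (tz _)).
  + exact: (splice_tensor (sur_l 0%N) (right_ses (U (u 0%N)))
      (right_ses (U (u 1%N))) (tz _)).
  + exact: (splice_tensor (sur_u n) (right_ses (U (u n.+1)))
      (right_ses (U (u n.+2))) (tz _)).
exists (right_incl (U (u 0%N))); have [inj ex sur] := right_ses (U (u 0%N)).
split=> // y; rewrite -ex /dup /=; split=> [|->]; last exact: linear0.
have [inj1 _ _] := right_ses (U (u 1%N)).
by rewrite -[X in _ = X](linear0 (right_incl (U (u 1%N)))) => /inj1.
Qed.

End Coinduction.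

End GorensteinFlatTheory.

(** * Dimensions through Tor *)

Lemma has_resolution_Omega (S : pzRingType) (P : lmodType S -> Prop) n M :
  (forall K : choiceType, P (free_module S K)) -> P (iter n (@Omega S) M) ->
  has_resolution P M n.
Proof.
move=> Pfree; elim: n M => [|n IH] M PM; first exact: has_resolution_self.
apply: (has_resolution_cons (Omega_short_exact M)) => //; apply: IH.
by rewrite -iterSr.
Qed.

Section FlatDimension.
Context (R : pzRingType).

(** Passing to the kernel of a flat cover lowers the length of the resolution and
    the degree of Tor by one. *)
Lemma flat_left_resolution_tor n j X (M : lmodType R) :
  has_resolution (@flat_left R) M n -> (n <= j)%N -> tor_zero j X M.
Proof.
elim: n M j => [|n IH] M j.
  move=> /has_resolution0[K [F [f [g [ses flatF K0]]]]] _.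
  apply: (tor_zero_trivial_sub ses K0); exact: flat_tor_zero.
move=> /has_resolutionS[K [F [f [g [ses flatF resK]]]]].
case: j => // j nj; apply: (tor_zero_quotient ses); first exact: IH resK nj.
exact: flat_tor_zero.
Qed.

Lemma flat_right_resolution_tor n j (X : lmodType R^c) (M : lmodType R) :
  has_resolution (@flat_right R) X n -> (n <= j)%N -> tor_zero j X M.
Proof.
move=> resX nj; apply/tor_zero_balance; elim: n X j resX nj => [|n IH] X j.
  move=> /has_resolution0[K [F [f [g [ses flatF K0]]]]] _.
  apply: (tor1_quotient_right ses); last exact: (flat_rightP F).1.
  apply: raddf_inj => t _; elim/tens_ind: t => [t u -> ->|x m].
    by rewrite subrr.
  by rewrite (K0 x) tensor0l.
move=> /has_resolutionS[K [F [f [g [ses flatF resK]]]]].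
case: j => // j nj; apply: (tor1_shift_quotient_right ses); first exact: IH.
exact: (flat_rightP F).1.
Qed.

(** The [n]-th syzygy is flat, and closes the resolution by free modules. *)
Lemma flat_left_resolution_of_tor n (M : lmodType R) :
  (forall X, tor_zero n X M) -> has_resolution (@flat_left R) M n.
Proof.
move=> tz; apply: has_resolution_Omega => [K|]; first exact: free_flat_left.
by apply/flat_leftP => X; apply/tor_zero_balance.
Qed.

Lemma flat_right_resolution_of_tor n (X : lmodType R^c) :
  (forall M : lmodType R, tor_zero n X M) -> has_resolution (@flat_right R) X n.
Proof.
move=> tz; apply: has_resolution_Omega => [K|]; first exact: free_flat_right.
by apply/flat_rightP => M; exact: tz.
Qed.

End FlatDimension.

Section Horseshoe.
Context (R : pzRingType).

Lemma flat_extension (K P M : lmodType R) (f : {linear K -> P})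
    (g : {linear P -> M}) :
  short_exact f g -> flat_left K -> flat_left M -> flat_left P.
Proof.
move=> ses /flat_leftP tzK /flat_leftP tzM; apply/flat_leftP => X.
exact: tor1_zero_extension ses (tzK X) (tzM X).
Qed.

Lemma flat_product (P Q : lmodType R) :
  flat_left P -> flat_left Q -> flat_left (P * Q)%type.
Proof.
have lin_i : linear (fun x : P => (x, 0) : P * Q).
  by move=> a u v; rewrite pair_lin scaler0 addr0.
have lin_p : linear (fun x : P * Q => x.2) by [].
apply: (@flat_extension _ _ _ (linear_of lin_i) (linear_of lin_p)); split.
- by move=> x y [].
- move=> [x y]; split=> [/= ->|[z [_ <-]]] //; by exists x.
- by move=> y; exists (0, y).
Qed.

(** A lift of the cover of [C] to [E] and the cover of [A] assemble to a cover
    of [E] by a flat module, whose kernel is an extension of the two syzygies. *)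
Lemma horseshoe (A E C : lmodType R) (f : {linear A -> E}) (g : {linear E -> C}) :
  short_exact f g ->
  exists (E' Q : lmodType R) (h : {linear E' -> Q}) (k : {linear Q -> E})
    (f' : {linear Omega A -> E'}) (g' : {linear E' -> Omega C}),
    [/\ short_exact h k, flat_left Q & short_exact f' g'].
Proof.
move=> [inj_f ex_g sur_g].
pose pA := free_cover A; pose pC := free_cover C.
have [inj_iA ex_pA sur_pA] := Omega_short_exact A.
have [inj_iC ex_pC sur_pC] := Omega_short_exact C.
have [s gs] := free_projective pC sur_g.
pose Q : lmodType R := (free_module R A * free_module R C)%type.
have lin_k : linear (fun x : Q => f (pA x.1) + s x.2).
  move=> a [u1 u2] [v1 v2].
  rewrite -[LHS]/(f (pA (a *: u1 + v1)) + s (a *: u2 + v2)) !linearP.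
  by rewrite addrACA -scalerDr.
pose k := linear_of lin_k.
have sur_k : onto k.
  move=> e; have [y yE] := sur_pC (g e).
  have /ex_g[a aE] : g (e - s y) = 0 by rewrite linearB /= gs yE subrr.
  have [x xE] := sur_pA a.
  by exists (x, y); rewrite -[LHS]/(f (pA x) + s y) /pA xE aE subrK.
have ses_k := ker_short_exact sur_k; set h := incl _ in ses_k.
have [inj_h ex_k _] := ses_k.
have lin_f : linear (fun x : Omega A => (Omega_incl A x, 0) : Q).
  by move=> a u v; rewrite linearP pair_lin scaler0 addr0.
have [f' f'E] : exists f' : {linear Omega A -> submodule_type (ker_submodule k)},
    forall x, h (f' x) = (Omega_incl A x, 0).
  apply: (lift_injective (h := linear_of lin_f) inj_h) => x; apply/ex_k.
  rewrite -[LHS]/(f (pA (Omega_incl A x)) + s 0) linear0 addr0.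
  by rewrite [pA _](exact_comp0 x ex_pA) linear0.
have lin_g : linear (fun x : submodule_type (ker_submodule k) => (h x).2).
  by move=> a u v; rewrite linearP.
have kh x : f (pA (h x).1) + s (h x).2 = 0 by exact: (exact_comp0 x ex_k).
have [g' g'E] : exists g' : {linear submodule_type (ker_submodule k) -> Omega C},
    forall x, Omega_incl C (g' x) = (h x).2.
  apply: (lift_injective (h := linear_of lin_g) inj_iC) => x; apply/ex_pC.
  rewrite -[LHS]/(pC (h x).2) -gs -[LHS]add0r.
  rewrite -[X in X + _](exact_comp0 (pA (h x).1) ex_g).
  by rewrite -linearD kh linear0.
exists _, Q, h, k, f', g'; split=> //.
  by apply: flat_product; exact: free_flat_left.
split.
- by move=> x y /(congr1 h); rewrite !f'E => -[/inj_iA].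
- move=> e; split=> [ge|[x <-]]; last first.
    by apply: inj_iC; rewrite g'E f'E linear0.
  have h2 : (h e).2 = 0 by rewrite -g'E ge linear0.
  have /ex_pA[x xE] : pA (h e).1 = 0.
    by apply: inj_f; have := kh e; rewrite h2 !linear0 addr0.
  by exists x; apply: inj_h; rewrite f'E xE -h2 -surjective_pairing.
- move=> c; have sc : g (s (Omega_incl C c)) = 0.
    by rewrite gs; exact: exact_comp0 ex_pC.
  have [a aE] := (ex_g _).1 sc; have [x xE] := sur_pA (- a).
  have [e eE] : exists e, h e = (x, Omega_incl C c).
    apply/ex_k; rewrite -[LHS]/(f (pA x) + s (Omega_incl C c)).
    by rewrite /pA xE linearN aE addNr.
  by exists e; apply: inj_iC; rewrite g'E eE.
Qed.

(** The middle term [E'] is an [n]-th syzygy of [E] in a flat resolution, so its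
    Tor groups are those of [E] shifted by [n]. *)
Lemma iterated_horseshoe n (A E C : lmodType R) (f : {linear A -> E})
    (g : {linear E -> C}) :
  short_exact f g ->
  exists (E' : lmodType R) (f' : {linear iter n (@Omega R) A -> E'})
    (g' : {linear E' -> iter n (@Omega R) C}),
    short_exact f' g' /\
    forall k X, tor_zero (k + n) X E -> tor_zero k X E'.
Proof.
move=> ses; elim: n => [|n [E1 [f1 [g1 [ses1 tz1]]]]].
  by exists E, f, g; split=> // k X; rewrite addn0.
have [E2 [Q [h [k [f2 [g2 [ses_k flatQ ses2]]]]]]] := horseshoe ses1.
exists E2, f2, g2; split=> // j X; rewrite addnS -addSn => /tz1 tz.
apply: (tor_zero_sub ses_k tz); exact: flat_tor_zero.
Qed.

End Horseshoe.

(** * Gorenstein flat dimension against flat dimension *)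

Section Comparison.
Context (R : pzRingType) (B : lmodType R^c -> Prop).

(** Degree 1 is the exactness of the tensored complex; the higher degrees follow
    by moving left along the complex. *)
Lemma Gorenstein_flat_tor_zero j X (G : lmodType R) :
  B X -> Gorenstein_flat B G -> tor_zero j X G.
Proof.
move=> BX; elim: j G => [|j IH] G /Gorenstein_flat_left.
  by move=> [K [F [f [g [_ tz]]]]]; exact: tz.
move=> [K [F [f [g [[ses flatF GFK] _]]]]].
by apply: (tor_zero_quotient ses); [exact: IH | exact: flat_tor_zero].
Qed.

Lemma Gorenstein_resolution_tor_zero n j X (M : lmodType R) :
  B X -> has_resolution (Gorenstein_flat B) M n -> (n <= j)%N -> tor_zero j X M.
Proof.
move=> BX; elim: n M j => [|n IH] M j.
  move=> /has_resolution0[K [F [f [g [ses GF K0]]]]] _.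
  apply: (tor_zero_trivial_sub ses K0); exact: Gorenstein_flat_tor_zero.
move=> /has_resolutionS[K [F [f [g [ses GF resK]]]]].
case: j => // j nj; apply: (tor_zero_quotient ses); first exact: IH resK nj.
exact: Gorenstein_flat_tor_zero.
Qed.

(** A module of finite Gorenstein flat dimension differs from one of finite flat
    dimension by a Gorenstein flat cokernel. The embedding [K -> H1] obtained
    for the first syzygy is pushed out along [K -> G]; the pushout [P] is an
    extension of Gorenstein flat modules, hence sits in a flat module [F], and
    [F / H1] receives [M = P / H1] with the same cokernel as [P] in [F]. *)
Lemma Gorenstein_embedding n (M : lmodType R) :
  closed_under_extensions (Gorenstein_flat B) ->
  has_resolution (Gorenstein_flat B) M n ->
  exists (H G : lmodType R) (f : {linear M -> H}) (g : {linear H -> G}),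
    [/\ short_exact f g, Gorenstein_flat B G
      & forall j X, (n <= j)%N -> tor_zero j X H].
Proof.
move=> ext; elim: n M => [|n IH] M.
  move=> /has_resolution0[K [G [f [g [[inj_f ex_g sur_g] GF K0]]]]].
  (* A resolution of length 0 identifies [M] with its only term. *)
  have inj_g : injective g.
    by apply: raddf_inj => x /ex_g[z <-]; rewrite (K0 z) linear0.
  have [k [gk kg]] := bijective_inverse inj_g sur_g.
  have [F [C [u [v [[inj_u ex_v sur_v] flatF GFC]]]]] := Gorenstein_flat_right GF.
  exists F, C, (u \o k), v; split=> // [|j X _]; last exact: flat_tor_zero.
  split=> // [x y /= /inj_u /(can_inj kg) //|y].
  rewrite ex_v; split=> [[x <-]|[x <-]]; last by exists (k x).
  by exists (g x); rewrite /= gk.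
move=> /has_resolutionS[K [G [i [p [ses_p GF resK]]]]].
have [H1 [G1 [j [q [ses_q GF1 tz1]]]]] := IH K resK.
have [P [a [p' [b [q' [ses_p' ses_q']]]]]] := pushout ses_q ses_p.
have GFP : Gorenstein_flat B P.
  by case: ses_q' => inj_b ex_q' sur_q'; exact: (ext _ _ _ b q').
have [F [C [u [v [[inj_u ex_v sur_v] flatF GFC]]]]] := Gorenstein_flat_right GFP.
have [inj_a ex_p' sur_p'] := ses_p'.
pose ua : {linear H1 -> F} := u \o a.
have inj_ua : injective ua by move=> x y /inj_u /inj_a.
have ses_pi := coker_short_exact inj_ua.
set pi := quotient_map _ in ses_pi; have [_ ex_pi sur_pi] := ses_pi.
have [f fE] : exists f : {linear M -> quotient_type (im_submodule ua)},
    forall y, f (p' y) = pi (u y).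
  apply: (factor_onto (w := pi \o u) sur_p') => y /ex_p'[h <-].
  exact: (exact_comp0 h ex_pi).
have [g gE] : exists g : {linear quotient_type (im_submodule ua) -> C},
    forall x, g (pi x) = v x.
  apply: factor_onto sur_pi _ => x /ex_pi[h <-]; exact: exact_comp0 ex_v.
exists _, C, f, g; split=> //; first split.
- apply: raddf_inj => x; have [y <-] := sur_p' x; rewrite /= fE => /ex_pi[h].
  by move=> /inj_u <-; exact: exact_comp0 ex_p'.
- move=> z; have [x <-] := sur_pi z; rewrite gE ex_v.
  split=> [[y <-]|[m mE]]; first by exists (p' y).
  have [y yE] := sur_p' m; move: mE; rewrite -yE fE => e.
  have /ex_pi[h hE] : pi (x - u y) = 0 by rewrite (linearB pi) e subrr.
  exists (y + a h); rewrite linearD /= -[u (a h)]/(ua h) hE addrC.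
  exact: subrK.
- by move=> c; have [x <-] := sur_v c; exists (pi x); rewrite gE.
case=> // j' X nj; apply: (tor_zero_quotient ses_pi); first exact: tz1.
exact: flat_tor_zero.
Qed.

(** The class of flat modules is closed under the trivial steps
    0 -> F = F and F = F -> 0. *)
Lemma flat_Gorenstein_flat (F : lmodType R) : flat_left F -> Gorenstein_flat B F.
Proof.
pose Z := free_module R void.
have Z0 (x : Z) : x = 0 by apply: free_ext => -[].
have flatZ : flat_left Z by exact: free_flat_left.
apply: (Gorenstein_flat_coinduction (C := @flat_left R)) => {}F flatF.
- by move=> X _; exact: (flat_leftP F).1.
- exists Z, F, \0, (id_module F); split=> //; split=> [x y _|y|y].
  + by rewrite (Z0 x) (Z0 y).
  + by split=> [y0|[x <-]] //; exists 0.
  + by exists y.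
- exists F, Z, (id_module F), \0; split=> //; split=> [x y|y|y] //.
  + by split=> // _; exists y.
  + by exists 0; rewrite (Z0 y).
Qed.

(** The [n]-th syzygies form a class as in [Gorenstein_flat_coinduction]. On the
    left, the kernel of the cover of a syzygy is the syzygy of a syzygy; on the
    right, embed the module into an injective [E], and the horseshoe places its
    [n]-th syzygy in one of [E], which is flat, with the [n]-th syzygy of the
    cokernel as quotient. *)
Lemma Omega_Gorenstein_flat n (M : lmodType R) :
  (forall X (N : lmodType R), B X -> tor_zero n X N) ->
  (forall E : lmodType R, injective_module E -> forall X, tor_zero n X E) ->
  Gorenstein_flat B (iter n (@Omega R) M).
Proof.
move=> tzB tzI.
pose C G := exists N : lmodType R, G = iter n (@Omega R) N.
apply: (Gorenstein_flat_coinduction (C := C)); last by exists M.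
- by move=> _ [N ->] X BX; apply/tor_zero_balance/tzB.
- move=> _ [N ->]; set H := iter n (@Omega R) N.
  exists (Omega H), (free_module R H), (Omega_incl H), (free_cover H).
  split; [exact: Omega_short_exact | exact: free_flat_left |].
  by exists (Omega N); rewrite -iterS iterSr.
move=> _ [N ->]; have [E [i [injE inj_i]]] := enough_injectives N.
have [E' [f [g [ses tz]]]] := iterated_horseshoe n (coker_short_exact inj_i).
exists E', _, f, g; split=> //; last by exists (quotient_type (im_submodule i)).
by apply/flat_leftP => X; apply: (tz 0%N); exact: tzI.
Qed.

End Comparison.

Theorem corollary3p8 (R : pzRingType) (B : lmodType R^c -> Prop)
  (injB : forall E : lmodType R^c, injective_module E -> B E)
  (extGF : closed_under_extensions (Gorenstein_flat B)) :
  lwGgl B \is a fin_num <->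
  (fd_right B \is a fin_num /\ fd_left (@injective_module R) \is a fin_num).
Proof.
have lwE : lwGgl B = class_resolution_dim (Gorenstein_flat B) (fun _ => True).
  rewrite /lwGgl /class_resolution_dim; congr supremum; apply/seteqP.
  by split=> d [M]; [move=> ->; exists M | move=> _ ->; exists M].
rewrite lwE /fd_right /fd_left !class_resolution_dim_finP.
split=> [[n resM]|[[m resB] [n resI]]].
  split; exists n => X hX; exists n => //.
    apply: flat_right_resolution_of_tor => M.
    have [k kn res] := resM M I; exact: Gorenstein_resolution_tor_zero hX res kn.
  have [k kn res] := resM X I.
  have [H [G [f [g [[inj_f _ _] _ tzH]]]]] := Gorenstein_embedding extGF res.
  have [r rf] := hX _ _ f (id_module X) inj_f.
  apply: flat_left_resolution_of_tor => Y; apply: tor_zero_retract rf _.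
  exact: tzH.
pose N := maxn m n; exists N => M _; exists N => //.
apply: has_resolution_Omega => [K|].
  exact/flat_Gorenstein_flat/free_flat_left.
apply: Omega_Gorenstein_flat => [X M' BX|E injE X].
  have [k km res] := resB X BX; apply: (flat_right_resolution_tor res).
  by rewrite leq_max km.
have [k kn res] := resI E injE; apply: (flat_left_resolution_tor res).
by rewrite leq_max kn orbT.
Qed.
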